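(* Let $R,Q$ be rational functions on $\mathbb{C}$. Then the meromorphic function $f(z)=R(z)e^z+Q(z)$ is Brody if and only if at least one of the following conditions is fulfilled: (1) $R\equiv 0$; or (2) $Q(\infty)\neq\infty$.
   Context: For a meromorphic function $f$ on $\mathbb{C}$ the spherical derivative is $f^\#(z)=\frac{|f'(z)|}{1+|f(z)|^2}$, extended continuously to the poles of $f$ (equivalently, computed there as $(1/f)^\#$). The function $f$ is called Brody if $f^\#$ is bounded on $\mathbb{C}$. $Q(\infty)$ denotes $\lim_{z\to\infty}Q(z)\in\mathbb{C}\cup\{\infty\}$. *)

(* Defs.v *)
(* MathComp / MathComp-Analysis *)
From mathcomp Require Import all_boot all_order all_algebra complex.
From mathcomp Require Import all_classical all_reals all_analysis.

Set Implicit Arguments.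
Unset Strict Implicit.
Unset Printing Implicit Defensive.

Import Order.TTheory GRing.Theory Num.Theory.
Import numFieldNormedType.Exports.

Local Open Scope classical_set_scope.
Local Open Scope ring_scope.
Local Open Scope complex_scope.

(* [R[i]] itself carries no topology; through its [numClosedFieldType]
   structure it inherits the one given by the modulus, as well as the
   normed-module structure over itself for which [derive1] is the complex
   derivative. *)
Definition Cplx (R : realType) : numClosedFieldType := R[i].

(* The [R]-valued modulus; [`|z|] is the same number, seen in [Cplx R]. *)
Definition cmod (R : realType) (z : Cplx R) : R := complex.Re `|z|.

Definition cexp (R : realType) (z : Cplx R) : Cplx R :=
  (expR (complex.Re z) * cos (complex.Im z))
    +i* (expR (complex.Re z) * sin (complex.Im z)).

(* The filter of neighbourhoods of infinity in C. *)
Definition cinfty (R : realType) : set_system (Cplx R) :=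
  filter_from [set: R] (fun M => [set z | M < cmod z]).

(* The Riemann sphere is [option C], with [None] for the point at infinity. *)
Definition sphere_cvg (R : realType) (F : set_system (Cplx R))
    (g : Cplx R -> Cplx R) (v : option (Cplx R)) : Prop :=
  if v is Some c then g z @[z --> F] --> c
  else cmod (g z) @[z --> F] --> +oo.

(* Defaults to infinity when there is no limit in the sphere. *)
Definition sphere_lim (R : realType) (F : set_system (Cplx R))
    (g : Cplx R -> Cplx R) : option (Cplx R) :=
  xget None [set v | sphere_cvg F g v].

(* Rational functions are elements of [{fraction {poly C}}].  The chosen
   representative need not be in lowest terms, so this function is only
   meaningful away from the finitely many zeros of its denominator; it is used
   below only through limits, which do not see these points. *)
Definition ratval (R : realType) (F : {fraction {poly Cplx R}})
    (z : Cplx R) : Cplx R :=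
  let q : {ratio {poly Cplx R}} := repr F in q.1.[z] / q.2.[z].

(* The meromorphic function C -> C u {oo} that a formula [g], valid off a
   discrete set, represents: removable singularities are filled in, and poles
   are sent to infinity. *)
Definition meromorphic_of (R : realType) (g : Cplx R -> Cplx R)
    (z : Cplx R) : option (Cplx R) :=
  sphere_lim z^' g.

(* Only meaningful where [f] is finite. *)
Definition spherical_formula (R : realType) (f : Cplx R -> option (Cplx R))
    (z : Cplx R) : R :=
  let f0 : Cplx R -> Cplx R := fun w => odflt 0 (f w) in
  cmod (derive1 f0 z) / (1 + cmod (f0 z) ^+ 2).

Definition spherical_derivative (R : realType)
    (f : Cplx R -> option (Cplx R)) (z : Cplx R) : R :=
  if f z is Some _ then spherical_formula f z
  else lim (spherical_formula f w @[w --> z^']).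

Definition Brody (R : realType) (f : Cplx R -> option (Cplx R)) : Prop :=
  exists M : R, forall z : Cplx R, spherical_derivative f z <= M.

(* Main.v *)
Require Import Defs.
From mathcomp Require Import all_boot all_order all_algebra complex.
From mathcomp Require Import ring lra.
From mathcomp Require Import all_classical all_reals all_analysis.

Set Implicit Arguments.
Unset Strict Implicit.
Unset Printing Implicit Defensive.

Import Order.TTheory GRing.Theory Num.Theory.
Import numFieldNormedType.Exports.

Local Open Scope classical_set_scope.
Local Open Scope ring_scope.
Local Open Scope complex_scope.

(** Write [R = p1 / q1] and [Q = p2 / q2].  Away from the zeros of
    [D = q1 q2] the function is [N / D], where [N = A e^z + B] with
    [A = p1 q2] and [B = p2 q1], and its spherical derivative is
    [|N' D - N D'| / (|D|^2 + |N|^2)].  Each of the finitely many zeros of [D]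
    contributes one real number to the supremum, so the function is Brody if
    and only if this quotient is bounded off the zeros of [D]
    ([Brody_meromorphic_ofP]).

    The quotient is always bounded near a given point [z0]
    ([spherical_quotient_local]).  If [D] vanishes to order [m] at [z0],
    replace [N] by a polynomial [W] that agrees with it to order [m + 1].  The
    numerator then changes by [O(|z - z0|^(2m))], which is dominated by
    [|D|^2].  For the polynomials [W] and [D], common powers of [z - z0]
    cancel in the quotient, and what remains of [W] and [D] does not vanish
    simultaneously.  By compactness only the behaviour at infinity matters.

    If [R = 0], or if [Q] is bounded at infinity, then
    [|N'| <= M (|N| + |D|)] for large [z], because the logarithmic derivative
    of a polynomial tends to 0 and because [A e^z = N - B] with [B = O(D)].
    Together with [|D'| <= |D|] this bounds the quotient
    ([spherical_quotient_bounded]).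

    Suppose now that [R <> 0] and that [Q] tends to infinity.  At a zero of
    [N] one has [A e^z = -B], hence [N' = -(1 + o(1)) B], and the quotient is
    [|N' / D|], about [|B / D| = |Q|], which is large at a large zero.  That
    [N] has arbitrarily large zeros ([exp_num_zeros]) follows from the minimum
    modulus principle.  Leading-term asymptotics give a far away
    point [c] where [A e^z] and [-B] nearly agree, so that
    [N (c + h) = q (1 - e^h + o(1))] for small [h], with [q] nearly [B c].
    Hence [|N|] is smaller at [c] than away from [c], and its minimum over a
    small square about [c] is attained inside.  There [N'] does not vanish, so
    a nonzero value of [N] could be decreased further
    ([modulus_descent]): the minimum is a zero. *)

(** * The modulus as a real number *)

Section Modulus.
Variable K : realType.
Local Notation C := (Cplx K).
Implicit Types (z w : C) (r : K).

Lemma cmodE z : `|z| = (cmod z)%:C.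
Proof. by rewrite /cmod normc_def. Qed.

Lemma cmodM z w : cmod (z * w) = cmod z * cmod w.
Proof. by apply: complexI; rewrite rmorphM -!cmodE normrM. Qed.

Lemma cmod_ge0 z : 0 <= cmod z.
Proof. by rewrite -lecR -cmodE normr_ge0. Qed.

Lemma cmod0 : cmod (0 : C) = 0.
Proof. by apply: complexI; rewrite -cmodE normr0. Qed.

Lemma cmod1 : cmod (1 : C) = 1.
Proof. by apply: complexI; rewrite -cmodE normr1. Qed.

Lemma cmodN z : cmod (- z) = cmod z.
Proof. by apply: complexI; rewrite -!cmodE normrN. Qed.

Lemma cmodC z w : cmod (z - w) = cmod (w - z).
Proof. by rewrite -cmodN opprB. Qed.

Lemma cmod_eq0 z : (cmod z == 0) = (z == 0).
Proof.
by rewrite -(inj_eq (@complexI K)) -cmodE normr_eq0.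
Qed.

Lemma cmod_gt0 z : (0 < cmod z) = (z != 0).
Proof. by rewrite lt_def cmod_ge0 andbT cmod_eq0. Qed.

Lemma cmodX z n : cmod (z ^+ n) = cmod z ^+ n.
Proof. by elim: n => [|n IH]; rewrite ?expr0 ?cmod1// !exprS cmodM IH. Qed.

Lemma cmodV z : cmod z^-1 = (cmod z)^-1.
Proof. by apply: complexI; rewrite fmorphV -!cmodE normfV. Qed.

Lemma ler_cmodD z w : cmod (z + w) <= cmod z + cmod w.
Proof. by rewrite -lecR rmorphD -!cmodE ler_normD. Qed.

Lemma ler_cmodB z w : cmod (z - w) <= cmod z + cmod w.
Proof. by rewrite -(cmodN w) ler_cmodD. Qed.

Lemma lerB_cmodD z w : cmod z - cmod w <= cmod (z + w).
Proof. by rewrite lerBlDr -{1}(addrK w z) ler_cmodB. Qed.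

Lemma cmod_real r : cmod (r%:C : C) = `|r|.
Proof. by rewrite /cmod normc_def/= expr0n/= addr0 sqrtr_sqr. Qed.

Lemma cmodi r : cmod ('i%C * r%:C : C) = `|r|.
Proof. by rewrite cmodM cmod_real /cmod normc_def/= expr0n/= add0r expr1n sqrtr1 mul1r. Qed.

Lemma ler_Re_cmod z : `|complex.Re z| <= cmod z.
Proof. by rewrite -lecR -cmodE normc_ge_Re. Qed.

Lemma ler_Im_cmod z : `|complex.Im z| <= cmod z.
Proof.
by rewrite -sqrtr_sqr /cmod normc_def/= ler_sqrt ?lerDr ?addr_ge0 ?sqr_ge0.
Qed.

Lemma cmod_le_ReIm z : cmod z <= `|complex.Re z| + `|complex.Im z|.
Proof.
rewrite {1}(complexE z); apply: le_trans (ler_cmodD _ _) _.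
by rewrite cmod_real cmodi.
Qed.

(** Radii in [nbhs] range over the complex numbers; this and the next two
    characterizations move them to [K], where real arithmetic is available. *)
Lemma nbhs_cmodP z (A : set C) :
  nbhs z A <-> exists2 e : K, 0 < e & forall w, cmod (w - z) < e -> A w.
Proof.
split=> [/nbhs_ballP[e/= e0 eA]|[e e0 eA]].
- exists (complex.Re e).
    by move: e0; rewrite ltcE => /andP[].
  move=> w wz; apply: eA; rewrite -ball_normE/= distrC cmodE.
  move: e0; rewrite !ltcE => /andP[/eqP e0 _]/=.
  by rewrite e0 eqxx.
- apply/nbhs_ballP; exists (e%:C) => /=; first by rewrite ltcR.
  move=> w; rewrite -ball_normE/= distrC cmodE => we.
  by apply: eA; rewrite -ltcR.
Qed.

Lemma dnbhs_cmodP z (A : set C) :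
  z^' A <-> exists2 e : K, 0 < e &
    forall w, w != z -> cmod (w - z) < e -> A w.
Proof.
rewrite /dnbhs /within/=; split=> [/nbhs_cmodP[e e0 H]|[e e0 H]].
  by exists e => // w wz we; apply: H.
by apply/nbhs_cmodP; exists e => // w we wz; exact: H.
Qed.

Lemma cvg_cmodP (T : Type) (F : set_system T) {FF : Filter F} (g : T -> C) (c : C) :
  g z @[z --> F] --> c <->
  forall e : K, 0 < e -> \forall z \near F, cmod (g z - c) < e.
Proof.
split=> [H e e0|H A /nbhs_cmodP[e e0 eA]].
  by apply: (H [set w | cmod (w - c) < e]); apply/nbhs_cmodP; exists e.
by apply: filterS (H e e0) => w /eA.
Qed.

Lemma continuous_cmod : continuous (@cmod K).
Proof.
move=> z; apply/(@cvgrPdist_lt _ K^o _ (nbhs z) _) => e e0.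
apply/nbhs_cmodP; exists e => // w we.
apply: le_lt_trans we; rewrite ler_norml.
have := ler_cmodD (w - z) z; have := ler_cmodD (z - w) w.
by rewrite !subrK cmodC; set a := cmod (w - z) => *; apply/andP; split; lra.
Qed.

End Modulus.

(** * Complex derivatives and the exponential *)

Section ComplexDerivative.
Variable K : realType.
Local Notation C := (Cplx K).
Implicit Types (z w h d : C) (r : K) (f : C -> C).

(** The first-order expansion, without a quotient: it can be used at [h = 0]. *)
Lemma is_derive_cmodP f z d :
  is_derive z 1 f d <->
  forall e : K, 0 < e -> exists2 r : K, 0 < r &
    forall h, cmod h < r -> cmod (f (z + h) - f z - d * h) <= e * cmod h.
Proof.
have quotE h : h != 0 ->
    f (z + h) - f z - d * h = (h^-1 * (f (h * 1 + z) - f z) - d) * h.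
  by move=> h0; rewrite mulr1 (addrC h) mulrBl mulrAC mulVf// mul1r.
split=> [[df Ed] e e0|H].
- have /cvg_cmodP/(_ e e0)/dnbhs_cmodP[r r0 Hr] : h^-1 *: (f (h *: 1 + z) - f z)
      @[h --> 0^'] --> d by rewrite -Ed; exact: df.
  exists r => // h hr; have [->|h0] := eqVneq h 0.
    by rewrite addr0 subrr mulr0 subr0 cmod0 mulr0.
  rewrite quotE// cmodM ler_pM2r ?cmod_gt0//; apply/ltW/Hr => //.
  by rewrite subr0.
- have cv : h^-1 *: (f (h *: 1 + z) - f z) @[h --> 0^'] --> d.
    apply/cvg_cmodP => e e0; have e20 : 0 < e / 2 by rewrite divr_gt0.
    have [r r0 Hr] := H _ e20; apply/dnbhs_cmodP; exists r => // h h0.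
    rewrite subr0 => hr; apply: le_lt_trans (_ : _ <= e / 2) _; last by lra.
    by rewrite -(@ler_pM2r _ (cmod h)) ?cmod_gt0// -cmodM -quotE// Hr.
  apply: DeriveDef; last exact: cvg_lim.
  by apply/cvg_ex; exists d.
Qed.

Lemma is_derive_horner (p : {poly C}) z : is_derive z 1 (horner p) p^`().[z].
Proof.
elim/poly_ind: p => [|p c IH].
  have -> : horner (0 : {poly C}) = cst 0 by apply/funext => y; rewrite horner0.
  by rewrite deriv0 horner0; exact: is_derive_cst.
have -> : horner (p * 'X + c%:P) = (horner p * id) + cst c.
  by apply/funext => y /=; rewrite !hornerE.
apply: is_derive_eq.
rewrite derivD derivM derivX derivC !addr0 mulr1 hornerD hornerM hornerX.
by rewrite addrC /GRing.scale/= mulr1 mulrC.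
Qed.

End ComplexDerivative.

Section ComplexExponential.
Variable K : realType.
Local Notation C := (Cplx K).
Implicit Types (z w h d : C) (r t : K) (g : K -> C).

Lemma cexpD z w : cexp (z + w) = cexp z * cexp w.
Proof.
case: z w => [a b] [c d]; apply/eqP; rewrite eq_complex/= expRD cosD sinD.
by apply/andP; split; apply/eqP; ring.
Qed.

Lemma cexp0 : cexp (0 : C) = 1.
Proof. by rewrite /cexp/= expR0 cos0 sin0 mulr1 mulr0. Qed.

Lemma cmod_cexp z : cmod (cexp z) = expR (complex.Re z).
Proof.
rewrite /cmod normc_def/=.
have -> : forall a b c : K, (a * b) ^+ 2 + (a * c) ^+ 2 =
  a ^+ 2 * (b ^+ 2 + c ^+ 2) by move=> *; ring.
by rewrite cos2Dsin2 mulr1 sqrtr_sqr ger0_norm// expR_ge0.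
Qed.

Lemma cexp_neq0 z : cexp z != 0.
Proof. by rewrite -cmod_gt0 cmod_cexp expR_gt0. Qed.

(** The derivative of a path is taken on real and imaginary parts, so that the
    real mean value theorem applies to each. *)
Definition is_path_derive g t d :=
  is_derive t 1 (fun s => complex.Re (g s)) (complex.Re d) /\
  is_derive t 1 (fun s => complex.Im (g s)) (complex.Im d).

(** The mean value theorem on the real and on the imaginary part; each
    contributes [M], whence the factor 2. *)
Lemma path_increment g (dg : K -> C) (M : K) :
  (forall t, is_path_derive g t (dg t)) ->
  (forall t, 0 <= t <= 1 -> cmod (dg t) <= M) ->
  cmod (g 1 - g 0) <= 2 * M.
Proof.
move=> Hg HM.
have mvt (u du : K -> K) : (forall t, is_derive t 1 u (du t)) ->
    (forall t, `|du t| <= cmod (dg t)) -> `|u 1 - u 0| <= M.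
  move=> Hu Hdu; have cu : {within `[0, 1], continuous u}.
    apply: continuous_subspaceT => x; apply: differentiable_continuous.
    by apply/derivable1_diffP; case: (Hu x).
  have [t t01 ->] := MVT_segment ler01 (fun t _ => Hu t) cu.
  by rewrite subr0 mulr1 (le_trans (Hdu t))// HM//; move: t01; rewrite in_itv.
apply: le_trans (cmod_le_ReIm _) _; rewrite mulr_natl mulr2n lerD//.
- rewrite raddfB; apply: (mvt (fun t => complex.Re (g t)) (fun t => complex.Re (dg t))).
    by move=> t; case: (Hg t).
  by move=> t; exact: ler_Re_cmod.
- rewrite raddfB; apply: (mvt (fun t => complex.Im (g t)) (fun t => complex.Im (dg t))).
    by move=> t; case: (Hg t).
  by move=> t; exact: ler_Im_cmod.
Qed.

Lemma is_path_deriveB g1 g2 t d1 d2 : is_path_derive g1 t d1 ->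
  is_path_derive g2 t d2 -> is_path_derive (fun s => g1 s - g2 s) t (d1 - d2).
Proof.
move=> [? ?] [? ?]; split; rewrite raddfB/=.
- under eq_fun do rewrite raddfB/=.
  exact: is_deriveB.
- under eq_fun do rewrite raddfB/=.
  exact: is_deriveB.
Qed.

Lemma is_path_derive_horner (p : {poly C}) h t :
  is_path_derive (fun s => p.[s%:C * h]) t (h * p^`().[t%:C * h]).
Proof.
elim/poly_ind: p => [|p c [IHr IHi]].
  by split; under eq_fun do rewrite horner0; rewrite deriv0 horner0 mulr0;
    exact: is_derive_cst.
rewrite derivD derivM derivX derivC !addr0 mulr1 hornerD hornerM hornerX.
set dp := p^`().[_] in IHr IHi *; clearbody dp.
split.
- have -> : (fun s : K => complex.Re (p * 'X + c%:P).[s%:C * h]) =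
      (fun s => complex.Re p.[s%:C * h]) * (fun s => s * complex.Re h)
      - (fun s => complex.Im p.[s%:C * h]) * (fun s => s * complex.Im h)
      + cst (complex.Re c).
    apply/funext => s; rewrite hornerD hornerM hornerX hornerC.
    have key q : complex.Re (q * (s%:C * h) + c) =
        complex.Re q * (s * complex.Re h) - complex.Im q * (s * complex.Im h)
        + complex.Re c.
      by case: h q c {dp IHr IHi} => [a b] [u v] [e f]/=; ring.
    exact: key.
  apply: is_derive_eq.
  rewrite /GRing.scale/=.
  case: h p.[_] dp {IHr IHi} => [a b] [u v] [e f]/=; ring.
- have -> : (fun s : K => complex.Im (p * 'X + c%:P).[s%:C * h]) =
      (fun s => complex.Re p.[s%:C * h]) * (fun s => s * complex.Im h)
      + (fun s => complex.Im p.[s%:C * h]) * (fun s => s * complex.Re h)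
      + cst (complex.Im c).
    apply/funext => s; rewrite hornerD hornerM hornerX hornerC.
    have key q : complex.Im (q * (s%:C * h) + c) =
        complex.Re q * (s * complex.Im h) + complex.Im q * (s * complex.Re h)
        + complex.Im c.
      by case: h q c {dp IHr IHi} => [a b] [u v] [e f]/=; ring.
    exact: key.
  apply: is_derive_eq.
  rewrite /GRing.scale/=.
  case: h p.[_] dp {IHr IHi} => [a b] [u v] [e f]/=; ring.
Qed.

Lemma is_path_derive_cexp h t :
  is_path_derive (fun s => cexp (s%:C * h)) t (h * cexp (t%:C * h)).
Proof.
case: h => a b; rewrite /cexp; split => /=.
- have -> : (fun s : K => expR (s * a - 0 * b) * cos (s * b + 0 * a)) =
      (fun s => expR (s * a)) * (fun s => cos (s * b)).
    by apply/funext => s; rewrite !mul0r subr0 addr0.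
  rewrite !mul0r subr0 addr0; apply: is_derive_eq.
  rewrite /GRing.scale/=; ring.
- have -> : (fun s : K => expR (s * a - 0 * b) * sin (s * b + 0 * a)) =
      (fun s => expR (s * a)) * (fun s => sin (s * b)).
    by apply/funext => s; rewrite !mul0r subr0 addr0.
  rewrite !mul0r subr0 addr0; apply: is_derive_eq.
  rewrite /GRing.scale/=; ring.
Qed.

End ComplexExponential.

Section ExponentialTaylor.
Variable K : realType.
Local Notation C := (Cplx K).
Implicit Types (z h : C) (n : nat).

Definition exp_poly n : {poly C} := \poly_(i < n) (i`!%:R)^-1.

Lemma deriv_exp_poly n : (exp_poly n.+1)^`() = exp_poly n.
Proof.
apply/polyP => i; rewrite coef_deriv !coef_poly ltnS; case: ltnP => [lt_in|_].
  rewrite factS natrM invfM -[LHS]mulr_natr mulrAC mulVf ?mul1r//.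
by rewrite mul0rn.
Qed.

Lemma exp_polyS_at0 n : (exp_poly n.+1).[0] = 1.
Proof. by rewrite horner_coef0 coef_poly/= fact0 invr1. Qed.

(** Induction on the order: the derivative of the remainder of order [n + 1]
    along the segment from 0 to [h] is [h] times the remainder of order [n]. *)
Lemma cexp_taylor n : exists2 M : K, 0 <= M &
  forall h, cmod h <= 1 -> cmod (cexp h - (exp_poly n).[h]) <= M * cmod h ^+ n.
Proof.
elim: n => [|n [M M0 IH]].
  exists (expR 1) => [|h h1]; first exact: expR_ge0.
  rewrite /exp_poly poly_def big_ord0 horner0 subr0 expr0 mulr1 cmod_cexp ler_expR.
  by rewrite (le_trans (ler_norm _))// (le_trans (ler_Re_cmod _)).
exists (2 * M) => [|h h1]; first by rewrite mulr_ge0.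
pose g (t : K) := cexp (t%:C * h) - (exp_poly n.+1).[t%:C * h].
pose dg (t : K) := h * cexp (t%:C * h) - h * (exp_poly n).[t%:C * h].
have -> : cexp h - (exp_poly n.+1).[h] = g 1 - g 0.
  by rewrite /g mul1r mul0r cexp0 exp_polyS_at0 subrr subr0.
rewrite -mulrA; apply: (@path_increment K g dg) => t.
  rewrite /dg -deriv_exp_poly; apply: is_path_deriveB.
    exact: is_path_derive_cexp.
  exact: is_path_derive_horner.
move=> /andP[t0 t1]; rewrite /dg -mulrBr cmodM exprS mulrCA.
have th : cmod (t%:C * h) <= cmod h.
  by rewrite cmodM cmod_real ger0_norm// ler_piMl ?cmod_ge0.
rewrite ler_wpM2l ?cmod_ge0//; apply: le_trans (IH _ (le_trans th h1)) _.
by rewrite ler_wpM2l// lerXn2r ?nnegrE ?cmod_ge0.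
Qed.

Lemma cexp_order2 : exists2 M : K, 0 < M &
  forall h, cmod h <= 1 -> cmod (cexp h - 1 - h) <= M * cmod h ^+ 2.
Proof.
have [M M0 HM] := cexp_taylor 2; exists (M + 1) => [|h h1]; first by lra.
have := HM h h1.
have -> : (exp_poly 2).[h] = 1 + h.
  rewrite /exp_poly poly_def !big_ord_recl big_ord0/= addr0 !hornerE/=.
  by rewrite factS !fact0 invr1 mul1r.
rewrite opprD addrA => /le_trans; apply.
by rewrite ler_wpM2r ?exprn_ge0 ?cmod_ge0//; lra.
Qed.

Lemma is_derive_cexp z : is_derive z 1 (@cexp K) (cexp z).
Proof.
apply/is_derive_cmodP => e e0; have [M M0 HM] := cexp_order2.
pose c := M * cmod (cexp z).
have c0 : 0 < c by rewrite mulr_gt0// cmod_gt0 cexp_neq0.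
exists (Num.min 1 (e / c)) => [|h]; first by rewrite lt_min ltr01 divr_gt0.
rewrite lt_min => /andP[/ltW h1]; rewrite ltr_pdivlMr// => he.
have -> : cexp (z + h) - cexp z - cexp z * h = cexp z * (cexp h - 1 - h).
  by rewrite cexpD; ring.
rewrite cmodM; apply: le_trans (ler_wpM2l (cmod_ge0 _) (HM h h1)) _.
rewrite [leLHS](_ : _ = cmod h * c * cmod h); last by rewrite /c; ring.
by rewrite ler_wpM2r ?cmod_ge0// ltW.
Qed.

(** Since [e^h - 1 = h + O(h^2)], the value 1 is taken only at 0 on a small
    disc, with a quantitative gap. *)
Lemma cexp_away1 : exists2 r : K, 0 < r <= 1 &
  forall h, cmod h <= r -> cmod h / 2 <= cmod (1 - cexp h).
Proof.
have [M M0 HM] := cexp_order2.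
exists (Num.min 1 (2 * M)^-1) => [|h].
  by rewrite lt_min ltr01 invr_gt0 mulr_gt0//= ge_min lexx.
rewrite le_min => /andP[h1]; rewrite -[_^-1]mul1r ler_pdivlMr ?mulr_gt0// => hM.
have := HM h h1. have := lerB_cmodD h (cexp h - 1 - h).
rewrite (_ : h + _ = - (1 - cexp h)); last by ring.
rewrite cmodN => B A; apply: le_trans B; have := cmod_ge0 h => c0.
nra.
Qed.

Lemma cexp_i (t : K) : cexp ('i%C * t%:C : C) = cos t +i* sin t.
Proof.
by rewrite /cexp/= !mul0r !mul1r ?oppr0 ?subr0 ?addr0 ?add0r expR0 !mul1r.
Qed.

(** The arc cosine of the real part gives the argument up to a sign, which the
    imaginary part determines. *)
Lemma unit_cexp z : cmod z = 1 -> exists t : K, cexp ('i%C * t%:C : C) = z.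
Proof.
case: z => a b; rewrite /cmod normc_def/= => E.
have ab : a ^+ 2 + b ^+ 2 = 1.
  by rewrite -[LHS]sqr_sqrtr ?addr_ge0 ?sqr_ge0// E expr1n.
have a1 : -1 <= a <= 1.
  have b2 := sqr_ge0 b; apply/andP; split; nra.
have cosa : cos (acos a) = a by rewrite acosK.
have sina : sin (acos a) = `|b|.
  by rewrite sin_acos// -ab addrAC subrr add0r sqrtr_sqr.
have [b0|b0] := leP 0 b.
  exists (acos a); rewrite cexp_i.
  by rewrite cosa sina ger0_norm.
exists (- acos a); rewrite cexp_i.
by rewrite cosN sinN cosa sina ltr0_norm ?opprK.
Qed.

Lemma cexp_period (t : K) n :
  cexp ('i%C * (t + n%:R * (2 * pi))%:C : C) = cexp ('i%C * t%:C).
Proof.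
elim: n => [|n IH]; first by rewrite mul0r addr0.
rewrite -IH -natr1 mulrDl mul1r addrA; set u := t + _.
by rewrite !cexp_i [2 * pi]mulr_natl (cosD2pi u) (sinD2pi u).
Qed.

End ExponentialTaylor.

(** * Polynomials and rational functions at infinity *)

Section PolynomialsAtInfinity.
Variable K : realType.
Local Notation C := (Cplx K).
Implicit Types (z : C) (p q : {poly C}) (n : nat).

#[global] Instance cinfty_filter : ProperFilter (@cinfty K).
Proof.
split.
  move=> [M _]; apply: (_ : ~ ([set z | M < cmod z] `<=` set0)) => /= H.
  apply: (H (`|M| + 1)%:C) => /=; rewrite cmod_real ger0_norm ?addr_ge0//.
  by rewrite ltr_pwDr// ler_norm.
apply: filter_from_filter; first by exists 0.
move=> M N _ _; exists (Num.max M N) => // z /=.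
by rewrite gt_max => /andP[].
Qed.

Lemma near_cinftyP (P : set C) :
  (\forall z \near @cinfty K, P z) <-> exists M : K, forall z, M < cmod z -> P z.
Proof. by split=> [[M _ H]|[M H]]; exists M => // z /H. Qed.

Lemma near_cinfty_gt (M : K) : \forall z \near @cinfty K, M < cmod z.
Proof. by apply/near_cinftyP; exists M. Qed.

(** Each monomial [z^i] with [i < n] satisfies [|z^i| |z| <= |z|^n] once
    [|z| >= 1]. *)
Lemma poly_growth p n : (size p <= n)%N -> exists2 M : K, 0 <= M &
  forall z, 1 <= cmod z -> cmod p.[z] * cmod z <= M * cmod z ^+ n.
Proof.
move=> pn; exists (\sum_(i < n) cmod p`_i) => [|z z1].
  by apply: sumr_ge0 => i _; exact: cmod_ge0.
rewrite (horner_coef_wide _ pn).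
apply: (@le_trans _ _ ((\sum_(i < n) cmod (p`_i * z ^+ i)) * cmod z)).
  rewrite ler_wpM2r ?cmod_ge0//.
  elim/big_rec2: _ => [|i x y _ yx]; first by rewrite cmod0.
  by rewrite (le_trans (ler_cmodD _ _))// lerD2l.
rewrite !mulr_suml ler_sum// => i _.
rewrite cmodM cmodX -mulrA -exprSr ler_wpM2l ?cmod_ge0//.
by rewrite ler_weXn2l.
Qed.

(** Subtracting the leading term lowers the degree, so that [poly_growth]
    gains a factor [1 / |z|]. *)
Lemma poly_equiv p (e : K) : 0 < e -> \forall z \near @cinfty K,
  cmod (p.[z] - lead_coef p * z ^+ (size p).-1) <= e * cmod z ^+ (size p).-1.
Proof.
move=> e0; set n := (size p).-1.
have sz : (size (p - lead_coef p *: 'X^n)%R <= n)%N.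
  apply/leq_sizeP => j nj; rewrite coefB coefZ coefXn.
  have [->|jn] := eqVneq j n; first by rewrite mulr1 subrr.
  rewrite mulr0 subr0 nth_default// (leq_trans (leqSpred _))//.
  by rewrite ltn_neqAle eq_sym jn.
have [M M0 HM] := poly_growth sz.
near=> z; have z1 : 1 < cmod z by near: z; exact: near_cinfty_gt.
have zM : M / e < cmod z by near: z; exact: near_cinfty_gt.
have := HM z (ltW z1); rewrite !hornerE.
move: (p.[z] - _) => d H; have z0 : 0 < cmod z by exact: lt_trans z1.
rewrite -(ler_pM2r z0); apply: le_trans H _.
rewrite mulrAC ler_wpM2r ?exprn_ge0 ?cmod_ge0//.
by rewrite mulrC -ler_pdivrMr// ltW.
Unshelve. all: by end_near. Qed.

Lemma poly_lower p : \forall z \near @cinfty K,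
  cmod (lead_coef p) / 2 * cmod z ^+ (size p).-1 <= cmod p.[z].
Proof.
have [->|p0] := eqVneq p 0.
  by near=> z; rewrite lead_coef0 cmod0 !mul0r cmod_ge0.
have l0 : 0 < cmod (lead_coef p) by rewrite cmod_gt0 lead_coef_eq0.
near=> z.
have : cmod (p.[z] - lead_coef p * z ^+ (size p).-1) <=
    cmod (lead_coef p) / 2 * cmod z ^+ (size p).-1.
  by near: z; apply: poly_equiv; rewrite divr_gt0.
have := lerB_cmodD (lead_coef p * z ^+ (size p).-1)
  (p.[z] - lead_coef p * z ^+ (size p).-1).
rewrite addrCA subrr addr0 cmodM cmodX => A B; lra.
Unshelve. all: by end_near. Qed.

Lemma poly_near_neq0 p : p != 0 -> \forall z \near @cinfty K, p.[z] != 0.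
Proof.
move=> p0; near=> z.
have pz : cmod (lead_coef p) / 2 * cmod z ^+ (size p).-1 <= cmod p.[z].
  by near: z; exact: poly_lower.
rewrite -cmod_gt0; apply: lt_le_trans pz.
rewrite mulr_gt0 ?exprn_gt0 ?divr_gt0 ?cmod_gt0 ?lead_coef_eq0//.
by rewrite -cmod_gt0; near: z; exact: near_cinfty_gt.
Unshelve. all: by end_near. Qed.

Lemma poly_ratio_small p q (e : K) : (size p < size q)%N -> 0 < e ->
  \forall z \near @cinfty K, cmod p.[z] <= e * cmod q.[z].
Proof.
move=> pq e0; have q0 : q != 0 by rewrite -size_poly_gt0 (leq_ltn_trans _ pq).
have pn : (size p <= (size q).-1)%N by rewrite -ltnS prednK// size_poly_gt0.
have [M M0 HM] := poly_growth pn.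
have l0 : 0 < cmod (lead_coef q) by rewrite cmod_gt0 lead_coef_eq0.
near=> z; have z1 : 1 < cmod z by near: z; exact: near_cinfty_gt.
have z0 : 0 < cmod z by exact: lt_trans z1.
have zM : 2 * M / (e * cmod (lead_coef q)) < cmod z.
  by near: z; exact: near_cinfty_gt.
have ql : cmod (lead_coef q) / 2 * cmod z ^+ (size q).-1 <= cmod q.[z].
  by near: z; exact: poly_lower.
rewrite -(ler_pM2r z0); apply: le_trans (HM _ (ltW z1)) _.
apply: (@le_trans _ _ (e * (cmod (lead_coef q) / 2 * cmod z ^+ (size q).-1) * cmod z)); last first.
  by rewrite ler_wpM2r ?(ltW z0)// ler_wpM2l// ltW.
rewrite (_ : e * _ * _ = cmod z * (e * cmod (lead_coef q)) / 2 * cmod z ^+ (size q).-1); last by ring.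
rewrite ler_wpM2r ?exprn_ge0 ?(ltW z0)//.
by rewrite ltr_pdivrMr ?mulr_gt0// in zM; lra.
Unshelve. all: by end_near. Qed.

(** Differentiation lowers the degree; for [p = 0] both sides vanish. *)
Lemma log_derivative_small p (e : K) : 0 < e ->
  \forall z \near @cinfty K, cmod p^`().[z] <= e * cmod p.[z].
Proof.
move=> e0; have [->|p0] := eqVneq p 0.
  by near=> z; rewrite deriv0 horner0 cmod0 mulr0.
by apply: poly_ratio_small => //; exact: lt_size_deriv.
Unshelve. all: by end_near. Qed.

(** Euclidean division [p = s q + r]: since [r / q] tends to 0, the behaviour at
    infinity is that of the polynomial [s], constant or not. *)
Lemma ratio_sphere_limit p q : q != 0 ->
  (exists c : C, p.[z] / q.[z] @[z --> @cinfty K] --> c) \/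
  cmod (p.[z] / q.[z]) @[z --> @cinfty K] --> +oo.
Proof.
move=> q0; pose s := (p %/ q)%R; pose r := (p %% q)%R.
have pE z : q.[z] != 0 -> p.[z] / q.[z] = s.[z] + r.[z] / q.[z].
  by move=> qz; rewrite {1}(divp_eq p q) !hornerE mulrDl mulfK.
have rq (e : K) : 0 < e -> \forall z \near @cinfty K, cmod (r.[z] / q.[z]) <= e.
  move=> e0; near=> z; have qz : 0 < cmod q.[z].
    by rewrite cmod_gt0; near: z; exact: poly_near_neq0.
  rewrite cmodM cmodV ler_pdivrMr//.
  by near: z; apply: poly_ratio_small => //; rewrite ltn_modp.
have [s1|s1] := leqP (size s) 1.
  left; exists s`_0; apply/cvg_cmodP => e e0; near=> z.
  rewrite pE; last by near: z; exact: poly_near_neq0.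
  rewrite {1}(size1_polyC s1) hornerC addrAC subrr add0r.
  apply: (@le_lt_trans _ _ (e / 2)); last by lra.
  by near: z; apply: rq; lra.
right; apply/cvgryPge => A.
have l0 : 0 < cmod (lead_coef s).
  by rewrite cmod_gt0 lead_coef_eq0 -size_poly_gt0 ltnW.
near=> z; rewrite pE; last by near: z; exact: poly_near_neq0.
have r1 : cmod (r.[z] / q.[z]) <= 1 by near: z; exact: rq.
have sz : cmod (lead_coef s) / 2 * cmod z ^+ (size s).-1 <= cmod s.[z].
  by near: z; exact: poly_lower.
have z1 : 1 < cmod z by near: z; exact: near_cinfty_gt.
have zA : 2 * (A + 1) / cmod (lead_coef s) < cmod z.
  by near: z; exact: near_cinfty_gt.
have zn : cmod z <= cmod z ^+ (size s).-1.
  by rewrite -[leLHS]expr1 ler_weXn2l ?(ltW z1)// -ltnS prednK// ltnW.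
rewrite ltr_pdivrMr// in zA.
have zs : cmod z * cmod (lead_coef s) <= 2 * cmod s.[z].
  apply: le_trans (_ : cmod z ^+ (size s).-1 * cmod (lead_coef s) <= _).
    by rewrite ler_wpM2r// ltW.
  rewrite -ler_pdivrMl//; apply: le_trans sz.
  by rewrite (mulrC _ (cmod (lead_coef s))) mulrA (mulrC _^-1).
have := lerB_cmodD s.[z] (r.[z] / q.[z]).
move: (cmod (s.[z] + _)) (cmod s.[z]) (cmod (r.[z] / _)) (cmod z * _) zA zs r1.
by clear=> a b c d *; lra.
Unshelve. all: by end_near. Qed.

End PolynomialsAtInfinity.

Section SphereLimits.
Variable K : realType.
Local Notation C := (Cplx K).

(** The sphere is Hausdorff: a finite limit keeps the function bounded, which
    excludes the point at infinity. *)
Lemma sphere_cvg_unique (F : set_system C) {FF : ProperFilter F} (g : C -> C) u v :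
  sphere_cvg F g u -> sphere_cvg F g v -> u = v.
Proof.
have excl c : sphere_cvg F g (Some c) -> sphere_cvg F g None -> False.
  move=> /cvg_cmodP/(_ 1 ltr01) Hc /cvgryPge/(_ (cmod c + 1)) Hy.
  have [z [/= gc gy]] := filter_ex (filterI Hc Hy).
  by have := lerB_cmodD (g z) (- c); rewrite cmodN; lra.
case: u v => [c|] [d|] // Hu Hv; last 2 first.
- by case: (excl c).
- by case: (excl d).
congr Some; move: Hu Hv => /=.
exact: (cvg_unique (@norm_hausdorff C C)).
Qed.

Lemma sphere_limE (F : set_system C) {FF : ProperFilter F} (g : C -> C) v :
  sphere_cvg F g v -> sphere_lim F g = v.
Proof.
move=> Hv; have := @xgetPex _ None [set v | sphere_cvg F g v].
by move=> H; apply: (@sphere_cvg_unique F _ g) => //; apply: H; exists v.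
Qed.

Lemma sphere_lim_finite (F : set_system C) (g : C -> C) :
  sphere_lim F g <> None -> exists c : C, g z @[z --> F] --> c.
Proof.
rewrite /sphere_lim; case: xgetP => // -[c|]// _ Hc _.
by exists c.
Qed.

End SphereLimits.

(** * The spherical quotient near a point *)

Section LocalBounds.
Variable K : realType.
Local Notation C := (Cplx K).
Implicit Types (z w h : C) (p q A B D U V P W : {poly C}).

Lemma continuous_of_is_derive (f : C -> C) z d :
  is_derive z 1 f d -> {for z, continuous f}.
Proof. by move=> [df _]; apply/differentiable_continuous/derivable1_diffP. Qed.

Lemma poly_near p z0 (e : K) : 0 < e ->
  \forall z \near z0, cmod (p.[z] - p.[z0]) < e.
Proof.
have /cvg_cmodP H := continuous_of_is_derive (is_derive_horner p z0).
exact: H.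
Qed.

Lemma poly_locally_bounded p z0 : exists2 M : K, 0 <= M &
  \forall z \near z0, cmod p.[z] <= M.
Proof.
exists (cmod p.[z0] + 1) => [|]; first by rewrite addr_ge0 ?cmod_ge0.
apply: filterS (poly_near p z0 ltr01) => z H.
by rewrite -(subrK p.[z0] p.[z]) (le_trans (ler_cmodD _ _))// addrC lerD2l ltW.
Qed.

Lemma poly_locally_away p z0 : p.[z0] != 0 -> exists2 c : K, 0 < c &
  \forall z \near z0, c <= cmod p.[z].
Proof.
rewrite -cmod_gt0 => p0; have c0 : 0 < cmod p.[z0] / 2 by rewrite divr_gt0.
exists (cmod p.[z0] / 2) => //; apply: filterS (poly_near p z0 c0) => z.
have := lerB_cmodD p.[z0] (p.[z] - p.[z0]); rewrite addrCA subrr addr0.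
by move: (cmod p.[z0]) (cmod p.[z]) (cmod (_ - _)); clear=> a b c *; lra.
Qed.

Lemma near_small z0 (e : K) : 0 < e -> \forall z \near z0, cmod (z - z0) < e.
Proof. by move=> e0; apply/nbhs_cmodP; exists e. Qed.

Definition exp_num A B z : C := A.[z] * cexp z + B.[z].
Definition exp_num_deriv A B z : C :=
  (A^`() + A).[z] * cexp z + B^`().[z].

(** The spherical derivative of [N / D] with the denominators cleared: a form
    symmetric in [N] and [D], which treats zeros and poles alike. *)
Definition spherical_quotient A B D z : K :=
  cmod (exp_num_deriv A B z * D.[z] - exp_num A B z * D^`().[z])
  / (cmod D.[z] ^+ 2 + cmod (exp_num A B z) ^+ 2).

Lemma spherical_quotient_le A B D z (M : K) : D.[z] != 0 ->
  (spherical_quotient A B D z <= M) =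
  (cmod (exp_num_deriv A B z * D.[z] - exp_num A B z * D^`().[z]) <=
   M * (cmod D.[z] ^+ 2 + cmod (exp_num A B z) ^+ 2)).
Proof.
move=> Dz; rewrite ler_pdivrMr//.
by rewrite ltr_pwDl ?exprn_gt0 ?cmod_gt0// exprn_ge0 ?cmod_ge0.
Qed.

(** The wronskian is quadratic in a common factor; this is why common factors
    cancel in the spherical quotient. *)
Lemma wronskianM U V P :
  (U * P)^`() * (V * P) - (U * P) * (V * P)^`() =
  (U^`() * V - U * V^`()) * P ^+ 2.
Proof. by rewrite !derivM; ring. Qed.

(** Replacing [(n, n')] by [(w, w')] changes the numerator of the spherical
    quotient by at most a multiple of [t^(2m)], and [|d|^2] dominates [t^(2m)].
    The bound on [t |d'|] is the form of [d' = O(t^(m - 1))] that is also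
    correct for [m = 0]. *)
Lemma wronskian_perturb (n n' d d' w w' : C) (t c c0 c1 : K) m :
  0 <= c -> 0 < c0 -> 0 <= c1 -> 0 <= t ->
  cmod (n - w) <= c * t ^+ m.+1 -> cmod (n' - w') <= c * t ^+ m ->
  c0 * t ^+ m <= cmod d -> t * cmod d' <= c * t ^+ m ->
  cmod (w' * d - w * d') <= c1 * (cmod d ^+ 2 + cmod n ^+ 2) ->
  cmod (n' * d - n * d') <=
    (c1 + c / c0 + (c / c0) ^+ 2) * (cmod d ^+ 2 + cmod n ^+ 2).
Proof.
move=> c_0 c00 c10 t0 H1 H2 H3 H4 H5.
have -> : n' * d - n * d' =
  (w' * d - w * d') + ((n' - w') * d + - ((n - w) * d')) by ring.
have T0 : 0 <= t ^+ m by rewrite exprn_ge0.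
have HT : t ^+ m <= cmod d / c0 by rewrite ler_pdivlMr// mulrC.
have d0 := cmod_ge0 d; have d'0 := cmod_ge0 d'.
have Ha : cmod ((n' - w') * d) <= c / c0 * cmod d ^+ 2.
  rewrite cmodM; apply: le_trans (_ : c * (cmod d / c0) * cmod d <= _).
    by rewrite ler_wpM2r// (le_trans H2)// ler_wpM2l.
  by rewrite le_eqVlt; apply/orP; left; apply/eqP; ring.
have Hb : cmod ((n - w) * d') <= (c / c0) ^+ 2 * cmod d ^+ 2.
  rewrite cmodM; apply: le_trans (ler_wpM2r d'0 H1) _.
  rewrite exprS (_ : c * _ * _ = c * t ^+ m * (t * cmod d')); last by ring.
  apply: le_trans (_ : (c * t ^+ m) ^+ 2 <= _).
    by rewrite expr2 ler_wpM2l// mulr_ge0.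
  rewrite -exprMn ler_pXn2r ?nnegrE ?mulr_ge0 ?divr_ge0 ?invr_ge0 ?(ltW c00)//.
  by rewrite -mulrA ler_wpM2l// mulrC.
apply: le_trans (ler_cmodD _ _) _.
have Hab := ler_cmodD ((n' - w') * d) (- ((n - w) * d')).
rewrite cmodN in Hab.
have e1 : 0 <= c / c0 by rewrite divr_ge0// ltW.
have e2 : 0 <= (c / c0) ^+ 2 by rewrite exprn_ge0.
have n2 : 0 <= cmod n ^+ 2 by rewrite exprn_ge0 ?cmod_ge0.
have e3 := mulr_ge0 e1 n2; have e4 := mulr_ge0 e2 n2.
rewrite [leRHS]mulrDl [in leRHS]mulrDl.
move: (c / c0) (cmod n ^+ 2) (cmod d ^+ 2) e1 e2 n2 e3 e4 H5 Hab Ha Hb => r x y.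
move: (cmod (_ - _)) (cmod (_ + _)) (cmod (_ * _)) (cmod (_ * _)).
clear=> u1 u2 u3 u4; nra.
Qed.

End LocalBounds.

Section LocalBoundedness.
Variable K : realType.
Local Notation C := (Cplx K).
Implicit Types (z w h : C) (p q A B D U V P W : {poly C}).

Lemma hornerXsubC_exp z z0 m : (('X - z0%:P) ^+ m).[z] = (z - z0) ^+ m.
Proof. by rewrite horner_exp hornerXsubC. Qed.

(** The derivative loses one order of vanishing, which the extra factor
    restores; stated as a product to include [m = 0]. *)
Lemma mul_deriv_root_exp U z0 m :
  ('X - z0%:P) * (U * ('X - z0%:P) ^+ m)^`() =
  (U^`() * ('X - z0%:P) + U *+ m) * ('X - z0%:P) ^+ m.
Proof.
rewrite derivM deriv_exp derivXsubC mul1r.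
case: m => [|m]; first by rewrite !expr0 !mulr0n; ring.
rewrite /= exprS -(mulr_natr U) -(mulr_natr (_ ^+ m)).
move: ('X - _) (_ ^+ m) (U^`()) (m.+1%:R) => X Y U' k.
by ring.
Qed.

(** [A e^z + B] with [e^z = e^z0 e^(z - z0)] truncated at order [m]. *)
Definition taylor_num A B z0 m : {poly C} :=
  A * (cexp z0 *: (exp_poly K m \Po ('X - z0%:P))) + B.

(** Expanding to order [m + 1] leaves an error of order [m] after
    differentiation, which is what [wronskian_perturb] needs. *)
Lemma taylor_numP A B z0 m : exists2 c : K, 0 <= c &
  \forall z \near z0,
  cmod (exp_num A B z - (taylor_num A B z0 m.+1).[z]) <= c * cmod (z - z0) ^+ m.+1 /\
  cmod (exp_num_deriv A B z - (taylor_num A B z0 m.+1)^`().[z])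
    <= c * cmod (z - z0) ^+ m.
Proof.
have [M1 M10 HM1] := cexp_taylor K m.+1; have [M2 M20 HM2] := cexp_taylor K m.
have [a a0 Ha] := poly_locally_bounded A z0.
have [b b0 Hb] := poly_locally_bounded A^`() z0.
pose e := cmod (cexp z0).
have e_0 : 0 <= e := cmod_ge0 _.
exists ((a + b) * e * M1 + a * e * M2).
  by rewrite addr_ge0// !mulr_ge0// addr_ge0.
near=> z.
have az : cmod A.[z] <= a by near: z.
have bz : cmod A^`().[z] <= b by near: z.
have h1 : cmod (z - z0) <= 1 by apply/ltW; near: z; exact: near_small.
have ez : cexp z = cexp z0 * cexp (z - z0) by rewrite -cexpD addrCA subrr addr0.
pose x := cexp (z - z0) - (exp_poly K m.+1).[z - z0].
pose y := cexp (z - z0) - (exp_poly K m).[z - z0].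
have Hx : cmod x <= M1 * cmod (z - z0) ^+ m.+1 := HM1 _ h1.
have Hy : cmod y <= M2 * cmod (z - z0) ^+ m := HM2 _ h1.
have -> : exp_num A B z - (taylor_num A B z0 m.+1).[z] = A.[z] * cexp z0 * x.
  rewrite /exp_num /taylor_num hornerD hornerM hornerZ horner_comp hornerXsubC ez /x.
  by ring.
have -> : exp_num_deriv A B z - (taylor_num A B z0 m.+1)^`().[z] =
    A^`().[z] * cexp z0 * x + A.[z] * cexp z0 * y.
  rewrite /exp_num_deriv /taylor_num derivD derivM derivZ deriv_comp derivXsubC.
  rewrite deriv_exp_poly mulr1.
  rewrite !(hornerD, hornerM, hornerZ) !horner_comp hornerXsubC ez /x /y.
  by ring.
have t0 := cmod_ge0 (z - z0).
have Tm : 0 <= cmod (z - z0) ^+ m by rewrite exprn_ge0.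
have Tm1 : 0 <= cmod (z - z0) ^+ m.+1 by rewrite exprn_ge0.
have TT : cmod (z - z0) ^+ m.+1 <= cmod (z - z0) ^+ m.
  by rewrite exprS ler_piMl.
have Ax : cmod (A.[z] * cexp z0 * x) <= a * e * M1 * cmod (z - z0) ^+ m.+1.
  by rewrite !cmodM -[leRHS]mulrA ler_pM ?mulr_ge0 ?cmod_ge0// ler_wpM2r.
have A'x : cmod (A^`().[z] * cexp z0 * x) <= b * e * M1 * cmod (z - z0) ^+ m.
  rewrite !cmodM -[leRHS]mulrA ler_pM ?mulr_ge0 ?cmod_ge0//.
    by rewrite ler_wpM2r.
  by rewrite (le_trans Hx)// ler_wpM2l.
have Ay : cmod (A.[z] * cexp z0 * y) <= a * e * M2 * cmod (z - z0) ^+ m.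
  by rewrite !cmodM -[leRHS]mulrA ler_pM ?mulr_ge0 ?cmod_ge0// ler_wpM2r.
split.
- apply: le_trans Ax _; rewrite ler_wpM2r// !mulrDl -addrA lerDl.
  by rewrite addr_ge0// !mulr_ge0.
- apply: le_trans (ler_cmodD _ _) _; apply: le_trans (lerD A'x Ay) _.
  rewrite -mulrDl ler_wpM2r// lerD2r !mulrDl lerDr.
  by rewrite !mulr_ge0.
Unshelve. all: by end_near. Qed.

(** Let [m] be the order of [D] at [z0] and [W] the polynomial approximating
    the numerator to order [m + 1].  If [W] vanishes to order at least [m]
    (possibly [W = 0]), the factor [(z - z0)^m] cancels and [D] bounds the
    denominator from below.  Otherwise [W], hence the numerator itself, has
    exact order [k < m], the factor [(z - z0)^k] cancels, and the numerator
    provides the lower bound. *)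
Lemma spherical_quotient_local A B D z0 : D != 0 -> exists M : K,
  \forall z \near z0, D.[z] != 0 -> spherical_quotient A B D z <= M.
Proof.
have arith (a w x y v : K) :
    y <= x -> a + a <= w -> x <= a -> w - y <= v -> a <= v by move=> *; lra.
move=> D0; have [m [D2 + DE]] := multiplicity_XsubC D z0.
rewrite D0/= => D2z0.
have [c c0 Hc] := taylor_numP A B z0 m.
pose W := taylor_num A B z0 m.+1; rewrite -/W in Hc.
have [k0 k00 Hk] := poly_locally_away D2z0.
have [d d0 Hd] := poly_locally_bounded (D2^`() * ('X - z0%:P) + D2 *+ m) z0.
have DzE z : cmod D.[z] = cmod D2.[z] * cmod (z - z0) ^+ m.
  by rewrite DE hornerM hornerXsubC_exp cmodM cmodX.
have [c1 c10 Hw] : exists2 c1 : K, 0 <= c1 & \forall z \near z0,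
  cmod (W^`().[z] * D.[z] - W.[z] * D^`().[z]) <=
  c1 * (cmod D.[z] ^+ 2 + cmod (exp_num A B z) ^+ 2).
  have [[U WE]|[k km [U Uz0 WE]]] :
      (exists U, W = U * ('X - z0%:P) ^+ m) \/
      (exists2 k, (k < m)%N & exists2 U, U.[z0] != 0 & W = U * ('X - z0%:P) ^+ k).
    have [W0|W0] := eqVneq W 0; first by left; exists 0; rewrite mul0r.
    have [k [U + WE]] := multiplicity_XsubC W z0; rewrite W0/= => Uz0.
    have [mk|km] := leqP m k; last by right; exists k => //; exists U.
    by left; exists (U * ('X - z0%:P) ^+ (k - m)); rewrite -mulrA -exprD subnK.
  - have [u u0 Hu] := poly_locally_bounded (U^`() * D2 - U * D2^`()) z0.
    exists (u / k0 ^+ 2); first by rewrite divr_ge0// exprn_ge0// ltW.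
    near=> z; rewrite -!hornerM -hornerN -hornerD WE {1 2}DE wronskianM.
    rewrite hornerM horner_exp hornerXsubC_exp cmodM !cmodX.
    have uz : cmod (U^`() * D2 - U * D2^`()).[z] <= u by near: z.
    have kz : k0 <= cmod D2.[z] by near: z.
    have tm : 0 <= cmod (z - z0) ^+ m by rewrite exprn_ge0 ?cmod_ge0.
    apply: (@le_trans _ _ (u * (cmod (z - z0) ^+ m) ^+ 2)).
      by rewrite ler_wpM2r// exprn_ge0.
    rewrite -mulrA ler_wpM2l// ler_pdivlMl ?exprn_gt0//.
    apply: (@le_trans _ _ (cmod D.[z] ^+ 2)); last by rewrite lerDl exprn_ge0 ?cmod_ge0.
    rewrite -exprMn DzE ler_pXn2r ?nnegrE ?mulr_ge0 ?cmod_ge0 ?(ltW k00)//.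
    by rewrite ler_wpM2r.
  - have cp : 0 < c + 1 by apply: ltr_pwDr.
    pose V := D2 * ('X - z0%:P) ^+ (m - k).
    have VE : D = V * ('X - z0%:P) ^+ k by rewrite -mulrA -exprD subnK// ltnW.
    have [u u0 Hu] := poly_locally_bounded (U^`() * V - U * V^`()) z0.
    have [l l0 Hl] := poly_locally_away Uz0.
    exists (u / (l / 2) ^+ 2); first by rewrite divr_ge0// exprn_ge0// divr_ge0// ltW.
    near=> z; rewrite -!hornerM -hornerN -hornerD WE {1 2}VE wronskianM.
    rewrite hornerM horner_exp hornerXsubC_exp cmodM !cmodX.
    have uz : cmod (U^`() * V - U * V^`()).[z] <= u by near: z.
    have lz : l <= cmod U.[z] by near: z.
    have tk : 0 <= cmod (z - z0) ^+ k by rewrite exprn_ge0 ?cmod_ge0.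
    have t0 := cmod_ge0 (z - z0).
    have l20 : 0 < l / 2 by rewrite divr_gt0.
    have [cz _] : cmod (exp_num A B z - W.[z]) <= c * cmod (z - z0) ^+ m.+1 /\
      cmod (exp_num_deriv A B z - W^`().[z]) <= c * cmod (z - z0) ^+ m by near: z.
    have t1 : cmod (z - z0) < 1 by near: z; exact: near_small.
    have tl : cmod (z - z0) < l / 2 / (c + 1).
      by near: z; apply: near_small; rewrite !divr_gt0.
    (* the exact order [k] of [W] survives the error term, of order [m + 1 > k] *)
    have lower : l / 2 * cmod (z - z0) ^+ k <= cmod (exp_num A B z).
      have Wl : l * cmod (z - z0) ^+ k <= cmod W.[z].
        by rewrite WE hornerM hornerXsubC_exp cmodM cmodX ler_wpM2r.
      have := lerB_cmodD W.[z] (exp_num A B z - W.[z]).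
      rewrite addrCA subrr addr0.
      have : c * cmod (z - z0) ^+ m.+1 <= l / 2 * cmod (z - z0) ^+ k.
        apply: (@le_trans _ _ (c * cmod (z - z0) * cmod (z - z0) ^+ k)).
          rewrite -mulrA -exprS ler_wpM2l// ler_wiXn2l// ?(ltW t1)//.
          exact: ltnW.
        rewrite ler_wpM2r//; move: tl; rewrite ltr_pdivlMr// => /ltW.
        apply: le_trans; rewrite mulrC ler_wpM2l// lerDl//.
      by rewrite {1}(splitr l) mulrDl in Wl; exact: arith cz Wl.
    apply: (@le_trans _ _ (u * (cmod (z - z0) ^+ k) ^+ 2)).
      by rewrite ler_wpM2r// exprn_ge0.
    rewrite -mulrA ler_wpM2l// ler_pdivlMl ?exprn_gt0//.
    apply: (@le_trans _ _ (cmod (exp_num A B z) ^+ 2)); last by rewrite lerDr exprn_ge0 ?cmod_ge0.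
    by rewrite -exprMn ler_pXn2r ?nnegrE ?mulr_ge0 ?cmod_ge0 ?invr_ge0 ?(ltW l0).
pose cc := c + d.
exists (c1 + cc / k0 + (cc / k0) ^+ 2).
near=> z => Dz; rewrite spherical_quotient_le//.
have [cz1 cz2] : cmod (exp_num A B z - W.[z]) <= c * cmod (z - z0) ^+ m.+1 /\
  cmod (exp_num_deriv A B z - W^`().[z]) <= c * cmod (z - z0) ^+ m by near: z.
have t0 := cmod_ge0 (z - z0).
apply: (@wronskian_perturb K _ _ _ _ W.[z] W^`().[z] (cmod (z - z0)) cc k0 c1 m) => //.
- by rewrite addr_ge0.
- by rewrite (le_trans cz1)// ler_wpM2r ?exprn_ge0// lerDl.
- by rewrite (le_trans cz2)// ler_wpM2r ?exprn_ge0// lerDl.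
- by rewrite DzE ler_wpM2r ?exprn_ge0//; near: z.
- rewrite -cmodM -[z - z0]hornerXsubC -hornerM {1}DE mul_deriv_root_exp.
  rewrite hornerM hornerXsubC_exp cmodM cmodX hornerXsubC ler_wpM2r ?exprn_ge0//.
  have dz : cmod (D2^`() * ('X - z0%:P) + D2 *+ m).[z] <= d by near: z.
  by rewrite (le_trans dz)// lerDr.
- by near: z.
Unshelve. all: by end_near. Qed.

End LocalBoundedness.

(** * Spherical derivatives and global boundedness *)

Section PlaneCompactness.
Variable K : realType.
Local Notation C := (Cplx K).

(** A square is the image of a product of two segments, which makes its
    compactness immediate. *)
Definition square (c : C) (r : K) : set C :=
  [set z | `|complex.Re (z - c)| <= r /\ `|complex.Im (z - c)| <= r].

Lemma compact_square c r : compact (square c r).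
Proof.
pose f (x : K * K) : C := c + (x.1 +i* x.2).
have -> : square c r = f @` (`[- r, r] `*` `[- r, r]).
  apply/seteqP; split=> [z [h1 h2]|_ [[x y] [/= hx hy] <-]].
    exists (complex.Re (z - c), complex.Im (z - c)).
      by split; rewrite /= in_itv/= -ler_norml.
    rewrite /f/=; case: z c {h1 h2 f} => [a b] [a' b'].
    by apply/eqP; rewrite eq_complex/=; apply/andP; split; apply/eqP; ring.
  rewrite /square/= /f/= (addrC c) addrK/= !ler_norml.
  by move: hx hy; rewrite !in_itv.
apply: continuous_compact; last by apply: compact_setX; exact: segment_compact.
apply: continuous_subspaceT => x; apply/cvg_cmodP => e e0.
have e2 : 0 < e / 2 by rewrite divr_gt0.
exists (ball x.1 (e / 2), ball x.2 (e / 2)).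
  by split; exact: nbhsx_ballx.
move=> y [h1 h2]; rewrite /f opprD addrACA subrr add0r.
apply: le_lt_trans (cmod_le_ReIm _) _; rewrite /= [ltRHS]splitr.
by rewrite -ball_normE/= in h1; rewrite -ball_normE/= in h2; rewrite distrC (distrC y.2) ltrD.
Qed.

(** Compactness of a large square, in the form of near coverings over the filter
    of bounds tending to [+oo]. *)
Lemma bounded_on_plane (F : C -> K) (P : C -> Prop) :
  (forall z0 : C, exists M : K, \forall z \near z0, P z -> F z <= M) ->
  (exists M : K, \forall z \near @cinfty K, P z -> F z <= M) ->
  exists M : K, forall z, P z -> F z <= M.
Proof.
move=> loc [M0 /near_cinftyP[r Hr]].
have /compact_near_coveringP/(_ K +oo (fun i z => P z -> F z <= i)) :=
  @compact_square 0 r.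
case.
  move=> z _; have [M HM] := loc z.
  exists ([set w | P w -> F w <= M], [set i | M <= i]).
    split => //; exists M; split; [exact: num_real | by move=> i /ltW].
  move=> [w i] /= [Hw Mi] Pw. exact: le_trans (Hw Pw) Mi.
move=> M1 [_ H]; exists (Num.max M0 (M1 + 1)) => z Pz; rewrite le_max.
have [rz|zr] := ltP r (cmod z); first by rewrite Hr.
apply/orP; right; apply: (H (M1 + 1)) => //; first by rewrite ltrDl.
rewrite /square/= subr0; split.
  exact: le_trans (ler_Re_cmod z) zr.
exact: le_trans (ler_Im_cmod z) zr.
Qed.

Lemma bounded_on_seq (F : C -> K) (s : seq C) :
  exists M : K, forall z, z \in s -> F z <= M.
Proof.
elim: s => [|x s [M HM]]; first by exists 0.
exists (Num.max (F x) M) => z; rewrite inE le_max => /predU1P[->|/HM ->].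
  by rewrite lexx.
by rewrite orbT.
Qed.

Lemma poly_roots_seq (D : {poly C}) : D != 0 ->
  exists s : seq C, forall z, D.[z] = 0 -> z \in s.
Proof.
move=> D0; have [s DE] := closed_field_poly_normal D; exists s => z.
rewrite DE hornerZ => /eqP; rewrite mulf_eq0 lead_coef_eq0 (negPf D0)/=.
by rewrite -/(root _ _) root_prod_XsubC.
Qed.

End PlaneCompactness.

Section SphericalDerivative.
Variable K : realType.
Local Notation C := (Cplx K).
Variables (A B D : {poly C}) (g : C -> C).
Implicit Types z w : C.
Hypothesis gE : forall z, D.[z] != 0 -> g z = exp_num A B z / D.[z].

Lemma is_derive_exp_num z : is_derive z 1 (exp_num A B) (exp_num_deriv A B z).
Proof.
have -> : exp_num A B = horner A * @cexp K + horner B by [].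
have H1 := is_derive_horner A z; have H2 := is_derive_horner B z.
have H3 := is_derive_cexp z.
apply: is_derive_eq; rewrite /exp_num_deriv hornerD /GRing.scale/=.
by rewrite mulrDl addrC (mulrC (cexp z)) [X in _ + X]addrC; ring.
Qed.

Lemma is_derive_quotient z : D.[z] != 0 ->
  is_derive z 1 (fun w => exp_num A B w / D.[w])
    ((exp_num_deriv A B z * D.[z] - exp_num A B z * D^`().[z]) / D.[z] ^+ 2).
Proof.
move=> Dz; have H1 := is_derive_exp_num z; have [H2 H3] := is_derive_horner D z.
have HV : is_derive z 1 (fun w => (D.[w])^-1) (- D.[z] ^- 2 *: D^`().[z]).
  by apply: DeriveDef; [exact: derivableV | rewrite deriveV// H3].
have -> : (fun w => exp_num A B w / D.[w]) = exp_num A B * (fun w => (D.[w])^-1).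
  by [].
apply: is_derive_eq; rewrite /GRing.scale/=.
by move: (exp_num _ _ _) (exp_num_deriv _ _ _) => n n'; field.
Qed.

Lemma near_denominator z : D.[z] != 0 -> \forall w \near z, D.[w] != 0.
Proof.
move=> /poly_locally_away[c c0]; apply: filterS => w.
by rewrite -cmod_gt0; exact: lt_le_trans.
Qed.

Lemma meromorphic_ofE z : D.[z] != 0 ->
  meromorphic_of g z = Some (exp_num A B z / D.[z]).
Proof.
move=> Dz; apply: sphere_limE => /=.
have /continuous_withinNx H := continuous_of_is_derive (is_derive_quotient Dz).
apply: cvg_trans H; apply: near_eq_cvg; apply: cvg_within.
by apply: filterS (near_denominator Dz) => w /gE ->.
Qed.

Lemma spherical_derivativeE z : D.[z] != 0 ->
  spherical_derivative (meromorphic_of g) z = spherical_quotient A B D z.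
Proof.
move=> Dz; rewrite /spherical_derivative meromorphic_ofE// /spherical_formula.
rewrite meromorphic_ofE//= derive1E.
have H := is_derive_quotient Dz.
rewrite (@near_eq_derive _ _ _ _ (fun w => exp_num A B w / D.[w])); last first.
  by apply: filterS (near_denominator Dz) => w Dw; rewrite meromorphic_ofE.
rewrite derive_val !cmodM !cmodV cmodX /spherical_quotient.
have : cmod D.[z] != 0 by rewrite cmod_eq0.
have : cmod D.[z] ^+ 2 + cmod (exp_num A B z) ^+ 2 != 0.
  by rewrite gt_eqF// ltr_pwDl ?exprn_gt0 ?cmod_gt0// exprn_ge0 ?cmod_ge0.
move: (cmod D.[z]) (cmod (exp_num A B z)) (cmod _) => d n x H0 d0.
by field; rewrite H0 d0.
Qed.

(** At the finitely many zeros of [D] the spherical derivative is some real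
    number, and finitely many real numbers are bounded. *)
Lemma Brody_meromorphic_ofP : D != 0 ->
  Brody (meromorphic_of g) <->
  exists M : K, forall z, D.[z] != 0 -> spherical_quotient A B D z <= M.
Proof.
move=> D0; split=> [[M HM]|[M HM]].
  by exists M => z Dz; rewrite -spherical_derivativeE.
(* the zeros of [D], where the formula fails, are a finite list *)
have [s Hs] := poly_roots_seq D0.
have [M' HM'] := bounded_on_seq (spherical_derivative (meromorphic_of g)) s.
exists (Num.max M M') => z; rewrite le_max.
have [Dz|Dz] := eqVneq D.[z] 0; first by rewrite HM' ?orbT ?Hs.
by rewrite spherical_derivativeE// HM.
Qed.

(** Near infinity [|D'| <= |D|], so the hypothesis bounds the numerator by a
    quadratic form in [|N|] and [|D|], hence by a multiple of
    [|D|^2 + |N|^2]. *)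
Lemma spherical_quotient_bounded : D != 0 ->
  (exists M : K, \forall z \near @cinfty K,
     cmod (exp_num_deriv A B z) <= M * (cmod (exp_num A B z) + cmod D.[z])) ->
  exists M : K, forall z, D.[z] != 0 -> spherical_quotient A B D z <= M.
Proof.
move=> D0 [M HM]; apply: bounded_on_plane.
  by move=> z0; exact: spherical_quotient_local.
have arith (m n n' d d' u : K) : 0 <= n -> 0 <= n' -> 0 <= d -> 0 <= d' ->
  n' <= m * (n + d) -> d' <= 1 * d -> u <= n' * d + n * d' ->
  u <= (2 * `|m| + 1) * (d ^+ 2 + n ^+ 2).
  move=> n0 n'0 d0 d'0 Hn Hd /le_trans; apply.
  have m0 := normr_ge0 m; have mm := ler_norm m.
  have {}Hn : n' <= `|m| * (n + d).
    by rewrite (le_trans Hn)// ler_wpM2r// addr_ge0.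
  have h1 : n' * d <= `|m| * (n + d) * d by rewrite ler_wpM2r.
  have h2 : n * d' <= n * d by rewrite ler_wpM2l//; rewrite mul1r in Hd.
  have h3 : `|m| * (n * d) <= `|m| * (d ^+ 2 + n ^+ 2) by rewrite ler_wpM2l//; nra.
  have h4 : `|m| * n ^+ 2 >= 0 by rewrite mulr_ge0// exprn_ge0.
  have h5 : n * d <= d ^+ 2 + n ^+ 2 by nra.
  have -> : (2 * `|m| + 1) * (d ^+ 2 + n ^+ 2) = `|m| * (d ^+ 2 + n ^+ 2) +
     `|m| * d ^+ 2 + `|m| * n ^+ 2 + (d ^+ 2 + n ^+ 2) by ring.
  have E : `|m| * (n + d) * d = `|m| * (n * d) + `|m| * d ^+ 2 by ring.
  rewrite E in h1; lra.
exists (2 * `|M| + 1); near=> z => Dz; rewrite spherical_quotient_le//.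
apply: (arith M _ (cmod (exp_num_deriv A B z)) _ (cmod D^`().[z]));
  rewrite ?cmod_ge0//.
- by near: z.
- by near: z; exact: log_derivative_small.
- by rewrite -!cmodM; exact: ler_cmodB.
Unshelve. all: by end_near. Qed.

End SphericalDerivative.

(** * Large zeros of A e^z + B *)

Section MinimumModulus.
Variable K : realType.
Local Notation C := (Cplx K).
Implicit Types (z w h : C) (A B p : {poly C}).

(** Moving by [-t f(z) / f'(z)] multiplies the value by [1 - t] up to [o(t)]. *)
Lemma modulus_descent (f : C -> C) z d (r : K) :
  is_derive z 1 f d -> d != 0 -> f z != 0 -> 0 < r ->
  exists2 h, cmod h < r & cmod (f (z + h)) < cmod (f z).
Proof.
move=> /is_derive_cmodP H d0 f0 r0.
have dd : 0 < cmod d by rewrite cmod_gt0.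
have ff : 0 < cmod (f z) by rewrite cmod_gt0.
have dd2 : 0 < cmod d / 2 by rewrite divr_gt0.
have [r' r'0 Hr'] := H _ dd2.
pose s := Num.min r r'; have s0 : 0 < s by rewrite lt_min r0.
pose q := cmod (f z) / cmod d; have q0 : 0 < q by rewrite divr_gt0.
pose t := Num.min 1 (s / 2 / q).
have t0 : 0 < t by rewrite lt_min ltr01/= !divr_gt0.
have t1 : t <= 1 by rewrite ge_min lexx.
have ts : t * q < s.
  apply: (@le_lt_trans _ _ (s / 2)).
    by rewrite -ler_pdivlMr// ge_min lexx orbT.
  by rewrite gtr_pMr// invf_lt1// ltr1n.
(* a Newton step, damped by [t] *)
pose h : C := - (t%:C * (f z / d)).
have hE : cmod h = t * q.
  by rewrite cmodN !cmodM cmodV cmod_real gtr0_norm.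
have := ts; rewrite -hE lt_min => /andP[hr hr'].
exists h => //.
have -> : f (z + h) = (1 - t)%:C * f z + (f (z + h) - f z - d * h).
  rewrite rmorphB rmorph1 /h; move: (f (z + _)) => u.
  by rewrite mulrN opprK mulrCA [d * _]mulrC divfK//; ring.
apply: le_lt_trans (ler_cmodD _ _) _.
apply: le_lt_trans (lerD (lexx _) (Hr' _ hr')) _.
rewrite hE cmodM cmod_real ger0_norm ?subr_ge0//.
rewrite (_ : cmod d / 2 * (t * q) = t * cmod (f z) / 2); last first.
  by rewrite /q; field; rewrite gt_eqF.
move: (cmod (f z)) ff => v v0; nra.
Qed.

(** Leading-term asymptotics with the leading monomial evaluated at a nearby
    reference point [w] in place of [z] itself, and a relative error. *)
Lemma poly_lead_approx p (e : K) : p != 0 -> 0 < e ->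
  exists2 s : K, 0 < s & exists Y : K, forall w z, Y < cmod w ->
    cmod (z - w) <= s * cmod w -> exists2 u : C, cmod u <= e &
    p.[z] = lead_coef p * w ^+ (size p).-1 * (1 + u).
Proof.
move=> p0 e0; set n := (size p).-1; set l := lead_coef p.
have l0 : 0 < cmod l by rewrite cmod_gt0 lead_coef_eq0.
have e20 : 0 < e / 2 by rewrite divr_gt0.
have /nbhs_cmodP[s s0 Hs] := @poly_near K 'X^n 1 _ e20.
have c0 : 0 < e / 2 * cmod l / 2 ^+ n by rewrite divr_gt0 ?exprn_gt0// mulr_gt0.
have /near_cinftyP[Y HY] := poly_equiv p c0.
pose s' := Num.min (s / 2) (1 / 2).
have s'0 : 0 < s' by rewrite lt_min !divr_gt0.
exists s' => //; exists (Num.max 0 (2 * Y)) => w z.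
rewrite gt_max => /andP[w0 wY] zw.
have wn0 : w != 0 by rewrite -cmod_gt0.
have s'h : s' <= 1 / 2 by rewrite ge_min lexx orbT.
have s's : s' < s by rewrite gt_min gtr_pMr// invf_lt1// ltr1n.
have zw2 : cmod (z - w) <= cmod w / 2.
  by rewrite (le_trans zw)// mulrC ler_wpM2l ?(ltW w0)//; rewrite mul1r in s'h.
have zY : Y < cmod z.
  have := lerB_cmodD w (z - w); rewrite addrCA subrr addr0.
  by move: zw2 wY; move: (cmod w) (cmod z) (cmod _); clear=> a b c *; lra.
have z2 : cmod z <= 2 * cmod w.
  have := ler_cmodD w (z - w); rewrite addrCA subrr addr0.
  have := cmod_ge0 w.
  by move: zw2; move: (cmod w) (cmod z) (cmod _); clear=> a b c *; lra.
have lw : 0 < cmod (l * w ^+ n) by rewrite cmodM cmodX mulr_gt0// exprn_gt0.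
have lwn0 : l * w ^+ n != 0 by rewrite -cmod_gt0.
exists (p.[z] / (l * w ^+ n) - 1); last by rewrite addrC subrK mulrC divfK.
have -> : p.[z] / (l * w ^+ n) - 1 =
    (p.[z] - l * z ^+ n) / (l * w ^+ n) + ((z / w) ^+ n - 1).
  rewrite expr_div_n mulrBl addrA; congr (_ + _); rewrite -addrA -[LHS]addr0.
  congr (_ + _); rewrite -mulf_div divff ?mul1r ?addNr//.
  by rewrite -cmod_gt0.
apply: le_trans (ler_cmodD _ _) _; rewrite [leRHS]splitr lerD//.
- rewrite [cmod (_ / _)]cmodM cmodV ler_pdivrMr//; apply: le_trans (HY _ zY) _.
  have zn : cmod z ^+ n <= 2 ^+ n * cmod w ^+ n.
    by rewrite -exprMn lerXn2r ?nnegrE ?mulr_ge0 ?cmod_ge0.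
  rewrite cmodM cmodX; apply: le_trans (ler_wpM2l (ltW c0) zn) _.
  have n0 : (2 : K) ^+ n != 0 by rewrite expf_neq0.
  move: ((2 : K) ^+ n) n0 (cmod w ^+ n) (cmod l) => k k0 v u.
  by rewrite le_eqVlt; apply/orP; left; apply/eqP; field.
- have := Hs (z / w); rewrite !hornerXn expr1n => H; apply/ltW/H.
  rewrite -[X in _ - X](divff wn0) -mulrBl cmodM cmodV ltr_pdivrMr//.
  by rewrite (le_lt_trans zw)// ltr_pM2r.
Qed.

(** Take [w = i y].  The argument of [- b w^n / (a w^m)] is then independent of
    [y > 0], so [y] can be chosen in an arithmetic progression of step
    [2 pi] with [e^(i y)] of that argument.  The real shift [x], which adjusts
    the modulus, is a logarithm of a power of [y], hence negligible compared
    with [y]. *)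
Lemma balanced_points (a b : C) m n (s Y : K) :
  a != 0 -> b != 0 -> 0 < s ->
  exists w : C, exists x : K, [/\ Y < cmod w, `|x| + 1 <= s * cmod w &
    a * w ^+ m * cexp (w + x%:C) = - (b * w ^+ n)].
Proof.
have arith1 (t u v t' y z : K) :
  - t <= t' -> v <= u -> t' + 1 + y + z < v -> 1 + y + z < t + u by move=> *; lra.
have arith2 (x l u v : K) : x <= l + u -> l + 1 <= v -> x + 1 <= v + u.
  by move=> *; lra.
move=> a0 b0 s0; pose c : K := cmod b / cmod a.
have c0 : 0 < c by rewrite divr_gt0 ?cmod_gt0.
have ci : ('i%C : C) != 0.
  by rewrite -cmod_eq0 -['i%C]mulr1 (cmodi (1 : K)) normr1 oner_eq0.
have i1 : cmod ('i%C : C) = 1 by rewrite -['i%C]mulr1 (cmodi (1 : K)) normr1.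
pose om : C := - (b * 'i%C ^+ n) / (a * 'i%C ^+ m) / c%:C.
have om1 : cmod om = 1.
  rewrite /om !cmodM !cmodV cmodN !cmodM !cmodX i1 !expr1n !mulr1 cmod_real.
  by rewrite gtr0_norm// divff// gt_eqF.
have [t Ht] := unit_cexp om1.
pose L := `|ln c| + 1 + 2 * (n + m)%:R.
have L0 : 0 < L by rewrite ltr_pwDl ?mulr_ge0// ltr_pwDr.
pose M := `|t| + 1 + `|Y| + (L / s) ^+ 2.
have M0 : 0 <= M by rewrite !addr_ge0// exprn_ge0// divr_ge0// ltW.
pose y := t + (Num.bound M)%:R * (2 * pi) : K.
have yM : 1 + `|Y| + (L / s) ^+ 2 < y.
  have := archi_boundP M0; have p2 := pi_ge2 K.
  have : (Num.bound M)%:R <= (Num.bound M)%:R * (2 * pi) :> K.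
    by rewrite ler_peMr//; lra.
  have nt : - t <= `|t| by rewrite -normrN ler_norm.
  by move=> h1 h2; exact: (arith1 _ _ _ _ _ _ nt h1 h2).
have y1 : 1 < y.
  by apply: le_lt_trans yM; rewrite -addrA lerDl addr_ge0// exprn_ge0// divr_ge0// ltW.
have y0 : 0 < y by apply: lt_trans y1.
pose w : C := 'i%C * y%:C.
have wE : cmod w = y by rewrite cmodi gtr0_norm.
pose x := ln (c * y ^+ n / y ^+ m).
exists w, x; rewrite wE; split.
- apply: le_lt_trans yM; apply: le_trans (ler_norm Y) _.
  by rewrite addrAC lerDr addr_ge0// exprn_ge0// divr_ge0// ltW.
- pose r := Num.sqrt y.
  have r1 : 1 <= r by rewrite -(@sqrtr1 K) ler_wsqrtr// ltW.
  have r0 : 0 < r by apply: lt_le_trans r1.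
  have ry : r ^+ 2 = y by rewrite sqr_sqrtr// ltW.
  (* [ln y = 2 ln (sqrt y) <= 2 sqrt y], so [y] beats every multiple of [ln y] *)
  have lny : 0 <= ln y <= 2 * r.
    rewrite ln_ge0 ?(ltW y1)//= -ry lnXn// -[leLHS]mulr_natl ler_wpM2l//.
    by rewrite ltW// ln_sublinear.
  have x_eq : x = ln c + n%:R * ln y - m%:R * ln y.
    rewrite /x; have yn : y ^+ n \is Num.pos by rewrite posrE exprn_gt0.
    have ym : y ^+ m \is Num.pos by rewrite posrE exprn_gt0.
    rewrite ln_div//; last by rewrite posrE mulr_gt0// exprn_gt0.
    by rewrite lnM// !lnXn// !mulr_natl.
  have xle : `|x| <= `|ln c| + (n + m)%:R * (2 * r).
    rewrite x_eq natrD mulrDl -addrA.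
    apply: le_trans (ler_normD _ _) _; rewrite lerD2l.
    apply: le_trans (ler_normB _ _) _.
    have /andP[l0 l2] := lny.
    by rewrite !normrM !normr_nat (ger0_norm l0) lerD// ler_wpM2l.
  have Lr : L / s <= r.
    rewrite -(@ler_pXn2r _ 2) ?nnegrE ?(ltW r0) ?divr_ge0 ?(ltW L0) ?(ltW s0)//.
    by rewrite ry; apply/ltW; apply: le_lt_trans yM; rewrite lerDr addr_ge0.
  rewrite -ry expr2 mulrA.
  apply: (@le_trans _ _ (L * r)); last first.
    by rewrite ler_wpM2r ?(ltW r0)// mulrC -ler_pdivrMr.
  have Lr' : `|ln c| + 1 <= (`|ln c| + 1) * r by rewrite ler_peMr// addr_ge0.
  rewrite /L mulrDl; apply: (arith2 _ _ _ _ _ Lr').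
  by rewrite (mulrC 2) -mulrA.
- rewrite cexpD /w cexp_period Ht.
  have -> : cexp (x%:C : C) = (c * y ^+ n / y ^+ m)%:C.
    rewrite /cexp/= cos0 sin0 mulr1 mulr0 /x lnK// posrE.
    by apply: divr_gt0; [apply: mulr_gt0 => //|]; rewrite exprn_gt0.
  have -> : (c * y ^+ n / y ^+ m)%:C = c%:C * y%:C ^+ n / y%:C ^+ m :> C.
    by rewrite rmorphM rmorphM fmorphV !rmorphXn.
  rewrite !exprMn /om.
  have yn0 : (y%:C : C) ^+ m != 0 by rewrite expf_neq0// -cmod_gt0 cmod_real normr_gt0 gt_eqF.
  have cn0 : (c%:C : C) != 0 by rewrite -cmod_gt0 cmod_real normr_gt0 gt_eqF.
  have im0 : ('i%C : C) ^+ m != 0 by rewrite expf_neq0.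
  move: ((y%:C : C) ^+ m) yn0 ((y%:C : C) ^+ n) => ym ym0 yn.
  move: (('i%C : C) ^+ m) im0 (('i%C : C) ^+ n) => im im0 ii.
  move: (c%:C : C) cn0 => cc cc0.
  by field; rewrite ?cc0 ?a0 ?im0 ?ym0.
Qed.

End MinimumModulus.

Section ZerosNearInfinity.
Variable K : realType.
Local Notation C := (Cplx K).
Implicit Types (z w h : C) (A B D : {poly C}).

(** [N' = (1 + A' / A) (N - B) + B'] with small [A' / A] and [B' / B]: where [N]
    is small compared with [B], the derivative is comparable with [B]. *)
Lemma exp_num_deriv_lower A B : \forall z \near @cinfty K,
  cmod B.[z] / 2 <= cmod (exp_num_deriv A B z) + 3 / 4 * cmod (exp_num A B z).
Proof.
have arith (x x' b b' n n' : K) : x' <= 1 / 4 * x -> b' <= 1 / 4 * b ->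
    b <= n + x -> x <= n' + x' + b' -> b / 2 <= n' + 3 / 4 * n.
  by move=> *; lra.
near=> z.
apply: (arith (cmod (A.[z] * cexp z)) (cmod (A^`().[z] * cexp z)) _ (cmod B^`().[z])).
- rewrite !cmodM mulrA ler_wpM2r ?cmod_ge0//.
  by near: z; apply: log_derivative_small; rewrite divr_gt0.
- by near: z; apply: log_derivative_small; rewrite divr_gt0.
- have -> : B.[z] = exp_num A B z - A.[z] * cexp z by rewrite /exp_num; ring.
  exact: ler_cmodB.
- have -> : A.[z] * cexp z =
      exp_num_deriv A B z - A^`().[z] * cexp z - B^`().[z].
    by rewrite /exp_num_deriv hornerD; ring.
  by apply: le_trans (ler_cmodB _ _) _; rewrite lerD2r ler_cmodB.
Unshelve. all: by end_near. Qed.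

(** The minimum of [|N|] over a square about [c = w + x] is a zero.  With
    [q = b w^n], the leading terms give [N (c + h) = q (1 - e^h)] up to an error
    [|q| rho / 16], whereas [|1 - e^h| >= rho / 4] for
    [rho / 2 <= |h| <= rho]. *)
Lemma exp_num_zeros A B (r : K) : A != 0 -> B != 0 ->
  exists2 z, r < cmod z & exp_num A B z = 0.
Proof.
move=> A0 B0; have [rho /andP[rho0 rho1] Hrho] := cexp_away1 K.
have /near_cinftyP[Y0 HY0] := exp_num_deriv_lower A B.
pose E : K := expR 1.
have E0 : 0 < E := expR_gt0 1.
(* the two relative errors enter with weights 1 and [|e^h| <= E]; see [eE] *)
pose e := rho / 16 / (1 + E).
have e0 : 0 < e by rewrite !divr_gt0// addr_gt0.
have eE : e + E * e = rho / 16 by rewrite /e; field; rewrite gt_eqF// addr_gt0.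
have e16 : e <= 1 / 16.
  have Ee : 0 <= E * e by rewrite mulr_ge0// ltW.
  by lra.
have [s1 s10 [Y1 H1]] := poly_lead_approx A0 e0.
have [s2 s20 [Y2 H2]] := poly_lead_approx B0 e0.
set a := lead_coef A in H1; set m := (size A).-1 in H1.
set b := lead_coef B in H2; set n := (size B).-1 in H2.
have a0 : a != 0 by rewrite lead_coef_eq0.
have b0 : b != 0 by rewrite lead_coef_eq0.
(* the bound 1/2 keeps the points of the disc at modulus at least [|w| / 2] *)
pose s := Num.min (1 / 2) (Num.min s1 s2).
have s0 : 0 < s by rewrite !lt_min divr_gt0// s10.
have ss1 : s <= s1 by rewrite !ge_min lexx orbT.
have ss2 : s <= s2 by rewrite !ge_min lexx !orbT.
have s12 : s <= 1 / 2 by rewrite ge_min lexx.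
pose Y := Num.max (Num.max Y1 Y2) (2 * Num.max `|r| `|Y0|).
have [w [x [Yw xw wE]]] := balanced_points m n Y a0 b0 s0.
move: Yw; rewrite !gt_max => /andP[/andP[Y1w Y2w] rw].
pose c := w + x%:C; pose q := b * w ^+ n.
have w0 : 0 < cmod w.
  by apply: le_lt_trans rw; rewrite mulr_ge0// le_max normr_ge0.
have q0 : 0 < cmod q by rewrite cmod_gt0 mulf_neq0// expf_neq0// -cmod_gt0.
(* the shift [x] is negligible compared with [w], and so is the disc *)
have near_w h : cmod h <= rho -> cmod (c + h - w) <= s * cmod w.
  move=> hr; apply: le_trans xw.
  have -> : c + h - w = x%:C + h by rewrite /c; ring.
  apply: le_trans (ler_cmodD _ _) _; rewrite cmod_real lerD2l.
  exact: le_trans hr rho1.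
have large h : cmod h <= rho -> Num.max `|r| `|Y0| < cmod (c + h).
  move=> /near_w hw; have := lerB_cmodD w (c + h - w).
  rewrite addrCA subrr addr0.
  have sw : s * cmod w <= 1 / 2 * cmod w by rewrite ler_wpM2r// ltW.
  have ar (u v d t : K) : 2 * u < v -> d <= t -> t <= 1 / 2 * v -> forall k, v - d <= k -> u < k.
    by move=> *; lra.
  exact: (ar _ _ _ _ rw hw sw).
have approx h : cmod h <= rho ->
    cmod (exp_num A B (c + h) - q * (1 - cexp h)) <= cmod q * (rho / 16) /\
    cmod (B.[c + h] - q) <= cmod q / 16.
  move=> hr; have hw := near_w h hr.
  have [|u1 u1e Az] := H1 w (c + h) Y1w.
    by rewrite (le_trans hw)// ler_wpM2r// ltW.
  have [|u2 u2e Bz] := H2 w (c + h) Y2w.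
    by rewrite (le_trans hw)// ler_wpM2r// ltW.
  split; last first.
    rewrite Bz -/q mulrDr mulr1 addrAC subrr add0r cmodM ler_wpM2l ?cmod_ge0//.
    by rewrite (le_trans u2e)//; rewrite mul1r in e16.
  have -> : exp_num A B (c + h) - q * (1 - cexp h) = q * (u2 - cexp h * u1).
    rewrite /exp_num Az Bz cexpD -/q.
    have -> : a * w ^+ m * (1 + u1) * (cexp c * cexp h) =
      a * w ^+ m * cexp c * ((1 + u1) * cexp h) by ring.
    by rewrite wE -/q; ring.
  rewrite cmodM ler_wpM2l ?cmod_ge0// -eE.
  apply: le_trans (ler_cmodB _ _) _; rewrite lerD// cmodM ler_pM ?cmod_ge0//.
  rewrite cmod_cexp ler_expR (le_trans (ler_norm _))// (le_trans (ler_Re_cmod _))//.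
  exact: le_trans hr rho1.
have contf : continuous (fun z => cmod (exp_num A B z)).
  move=> z; apply: continuous_comp; last exact: continuous_cmod.
  exact: continuous_of_is_derive (is_derive_exp_num A B z).
have rho2 : 0 <= rho / 2 by rewrite divr_ge0// ltW.
have [z1 /set_mem z1S z1min] : exists2 z1, z1 \in square c (rho / 2) &
    forall z, z \in square c (rho / 2) ->
      cmod (exp_num A B z1) <= cmod (exp_num A B z).
  apply: compact_EVT_min; last exact: continuous_subspaceT.
    by exists c; rewrite /square/= subrr !normr0.
  exact: compact_square.
have sqh z : square c (rho / 2) z -> cmod (z - c) <= rho.
  by move=> [hx hy]; rewrite (le_trans (cmod_le_ReIm _))// (splitr rho) lerD.
have centre : cmod (exp_num A B z1) <= cmod q * (rho / 16).
  apply: le_trans (z1min c _) _.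
    by rewrite inE /square/= subrr !normr0.
  have [|+ _] := approx 0; first by rewrite cmod0 ltW.
  by rewrite addr0 cexp0 subrr mulr0 subr0.
have z1c : cmod (z1 - c) <= rho := sqh _ z1S.
have [N1 B1] := approx _ z1c; rewrite addrCA subrr addr0 in N1 B1.
(* outside the disc of radius [rho / 2] the modulus exceeds its value at [c] *)
have inner : cmod (z1 - c) < rho / 2.
  rewrite ltNge; apply/negP => out.
  have low := Hrho _ z1c.
  have := lerB_cmodD (q * (1 - cexp (z1 - c)))
    (exp_num A B z1 - q * (1 - cexp (z1 - c))).
  rewrite addrCA subrr addr0 cmodM.
  have ql : cmod q * (rho / 4) <= cmod q * cmod (1 - cexp (z1 - c)).
    by rewrite ler_wpM2l ?cmod_ge0//; lra.
  have qr : 0 < cmod q * (rho / 16) by rewrite mulr_gt0// divr_gt0.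
  have qE : cmod q * (rho / 4) = 4 * (cmod q * (rho / 16)) by field.
  have ar (t v k l : K) : 0 < t -> 4 * t <= v -> k <= t -> l <= t -> v - k <= l -> False.
    by move=> *; lra.
  rewrite qE in ql; exact: ar qr ql N1 centre.
have [z1large z1Y0] : `|r| < cmod z1 /\ `|Y0| < cmod z1.
  have := large _ z1c; rewrite addrCA subrr addr0 gt_max.
  by move=> /andP[].
exists z1; first exact: le_lt_trans (ler_norm r) z1large.
apply/eqP/negPn/negP => Nz1.
have dz1 : exp_num_deriv A B z1 != 0.
  have := HY0 _ (le_lt_trans (ler_norm Y0) z1Y0).
  rewrite -cmod_eq0; apply: contraTneq => ->; rewrite -ltNge add0r.
  have := lerB_cmodD q (B.[z1] - q); rewrite addrCA subrr addr0.
  have : cmod q * (rho / 16) <= cmod q * (1 / 16).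
    by rewrite ler_wpM2l ?cmod_ge0//; lra.
  have ar (t k l v d : K) : 0 < t -> l <= k -> d <= t / 16 -> k <= t * (1 / 16) ->
    t - d <= v -> 3 / 4 * l < v / 2 by move=> *; lra.
  exact: ar q0 centre B1.
(* a descent step shorter than [gap] stays in the square *)
have gap : 0 < rho / 2 - cmod (z1 - c) by rewrite subr_gt0.
have [h hgap hlt] := modulus_descent (is_derive_exp_num A B z1) dz1 Nz1 gap.
have : square c (rho / 2) (z1 + h).
  have hc : cmod (z1 + h - c) <= rho / 2.
    rewrite addrAC (le_trans (ler_cmodD _ _))//.
    by rewrite -lerBrDl ltW.
  by split; [exact: le_trans (ler_Re_cmod _) hc | exact: le_trans (ler_Im_cmod _) hc].
by move=> /mem_set/z1min; rewrite leNgt hlt.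
Qed.

End ZerosNearInfinity.

(** * Growth at infinity and the theorem *)

Section GrowthAtInfinity.
Variable K : realType.
Local Notation C := (Cplx K).
Implicit Types (z : C) (A B D : {poly C}).

Lemma poly_deriv_growth B D : exists M : K, \forall z \near @cinfty K,
  cmod (exp_num_deriv 0 B z) <= M * (cmod (exp_num 0 B z) + cmod D.[z]).
Proof.
exists 1; near=> z; rewrite /exp_num_deriv /exp_num deriv0 addr0 horner0.
rewrite mul0r !add0r mul1r.
have H : cmod B^`().[z] <= 1 * cmod B.[z].
  by near: z; exact: log_derivative_small.
by rewrite mul1r in H; rewrite (le_trans H)// lerDl cmod_ge0.
Unshelve. all: by end_near. Qed.

(** [N' = A' e^z + A e^z + B'], where [A' e^z] and [B'] are dominated by
    [A e^z] and [B], and [A e^z = N - B]. *)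
Lemma exp_num_deriv_growth A B D (k : K) : 0 <= k ->
  (\forall z \near @cinfty K, cmod B.[z] <= k * cmod D.[z]) ->
  exists M : K, \forall z \near @cinfty K,
    cmod (exp_num_deriv A B z) <= M * (cmod (exp_num A B z) + cmod D.[z]).
Proof.
move=> k0 HB.
have arith (x x' b b' n d : K) : 0 <= n -> 0 <= d -> x' <= 1 * x ->
    b' <= 1 * b -> b <= k * d -> x <= n + b ->
    x' + x + b' <= (2 + 3 * k) * (n + d).
  move=> n0 d0 hx hb hd hn.
  have kn : 0 <= k * n by rewrite mulr_ge0.
  have -> : (2 + 3 * k) * (n + d) =
    2 * n + 2 * d + 3 * (k * n) + 3 * (k * d) by ring.
  lra.
exists (2 + 3 * k); near=> z.
apply: le_trans (_ : cmod (A^`().[z] * cexp z) + cmod (A.[z] * cexp z)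
  + cmod B^`().[z] <= _).
  rewrite /exp_num_deriv hornerD mulrDl.
  by apply: le_trans (ler_cmodD _ _) _; rewrite lerD2r ler_cmodD.
apply: (arith _ _ (cmod B.[z])); rewrite ?cmod_ge0//.
- rewrite !cmodM mulrA ler_wpM2r ?cmod_ge0//.
  by near: z; exact: log_derivative_small.
- by near: z; exact: log_derivative_small.
- by near: z.
- have -> : A.[z] * cexp z = exp_num A B z - B.[z] by rewrite /exp_num addrK.
  exact: ler_cmodB.
Unshelve. all: by end_near. Qed.

(** At a zero of the numerator the quotient is [|N' / D|], which is at least
    [|B / D| / 2] by [exp_num_deriv_lower]. *)
Lemma spherical_quotient_unbounded A B D : A != 0 -> B != 0 ->
  cmod (B.[z] / D.[z]) @[z --> @cinfty K] --> +oo -> D != 0 ->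
  ~ exists M : K, forall z, D.[z] != 0 -> spherical_quotient A B D z <= M.
Proof.
move=> A0 B0 /cvgryPgt BD D0 [M HM].
have [r Hr] : exists r : K, forall z, r < cmod z ->
  [/\ D.[z] != 0, 2 * M < cmod (B.[z] / D.[z]) &
    cmod B.[z] / 2 <= cmod (exp_num_deriv A B z) + 3 / 4 * cmod (exp_num A B z)].
  apply/near_cinftyP; near=> z; split; near: z.
  - exact: poly_near_neq0.
  - exact: BD.
  - exact: exp_num_deriv_lower.
have [z /Hr[Dz BDz lz] Nz] := exp_num_zeros r A0 B0.
have := HM z Dz; rewrite spherical_quotient_le// Nz mul0r subr0 cmod0 expr0n/= addr0.
rewrite Nz cmod0 mulr0 addr0 in lz.
have d0 : 0 < cmod D.[z] by rewrite cmod_gt0.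
rewrite cmodM expr2 mulrA ler_pM2r// leNgt => /negP; apply.
apply: lt_le_trans lz; move: BDz; rewrite cmodM cmodV ltr_pdivlMr// => h.
by rewrite ltr_pdivlMr// mulrC mulrA.
Unshelve. all: by end_near. Qed.

End GrowthAtInfinity.

Section RationalFunctions.
Variable K : realType.
Local Notation C := (Cplx K).
Implicit Types (z : C) (F : {fraction {poly C}}).

(** The numerator and denominator of the representative chosen by [ratval];
    they may have common factors. *)
Definition numer F : {poly C} := (frac (repr F)).1.
Definition denom F : {poly C} := (frac (repr F)).2.

Lemma denom_neq0 F : denom F != 0.
Proof. exact: denom_ratioP. Qed.

Lemma ratvalE F z : ratval F z = (numer F).[z] / (denom F).[z].
Proof. by []. Qed.

Lemma numer_eq0 F : (numer F == 0) = (F == 0).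
Proof.
rewrite /numer FracField.numer0 reprK -tofrac0; unlock FracField.tofrac.
by rewrite -[ratio0 _]FracField.Ratio_numden.
Qed.

End RationalFunctions.


Theorem proposition2 (K : realType) (R Q : {fraction {poly Cplx K}}) :
  Brody (meromorphic_of (fun z : Cplx K => ratval R z * cexp z + ratval Q z))
  <-> (R = 0 \/ sphere_lim (@cinfty K) (ratval Q) <> None).
Proof.
pose A := numer R * denom Q.
pose B := numer Q * denom R.
pose D := denom R * denom Q.
have D0 : D != 0 by rewrite mulf_neq0 ?denom_neq0.
have fE z : D.[z] != 0 ->
    ratval R z * cexp z + ratval Q z = exp_num A B z / D.[z].
  rewrite /D hornerM mulf_eq0 negb_or => /andP[Rz Qz].
  rewrite !ratvalE /exp_num /A /B !hornerM.
  by move: (cexp z) => e; field; rewrite Qz Rz.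
have QE : \forall z \near @cinfty K, B.[z] / D.[z] = ratval Q z.
  near=> z; have : D.[z] != 0 by near: z; exact: poly_near_neq0.
  rewrite /D hornerM mulf_eq0 negb_or => /andP[Rz Qz].
  by rewrite ratvalE /B !hornerM; field; rewrite Qz Rz.
apply: iff_trans (Brody_meromorphic_ofP fE D0) _; split=> [bounded|cond].
- have [R0|R0] := eqVneq R 0; first by left.
  right=> Qoo.
  have [[c Hc]|Hoo] := ratio_sphere_limit (numer Q) (denom_neq0 Q).
    by rewrite (@sphere_limE _ _ _ (ratval Q) (Some c)) in Qoo.
  apply: spherical_quotient_unbounded D0 bounded.
  + by rewrite mulf_neq0 ?denom_neq0// numer_eq0.
  + rewrite mulf_neq0 ?denom_neq0//; apply/eqP => Q0.
    move: Hoo => /cvgryPgt/(_ 0)/filter_ex[z].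
    by rewrite Q0 horner0 mul0r cmod0 ltxx.
  + apply: cvg_trans Hoo; apply: near_eq_cvg.
    by apply: filterS QE => z ->; rewrite ratvalE.
- apply: spherical_quotient_bounded => //.
  case: cond => [R0|/sphere_lim_finite[c /cvg_cmodP/(_ 1 ltr01) Hc]].
    have -> : A = 0.
      by move/eqP: R0; rewrite -numer_eq0 /A => /eqP ->; rewrite mul0r.
    exact: poly_deriv_growth.
  apply: (@exp_num_deriv_growth _ _ _ _ (cmod c + 1)).
    by rewrite addr_ge0 ?cmod_ge0.
  near=> z.
  have Dz : D.[z] != 0 by near: z; exact: poly_near_neq0.
  have cz : cmod (ratval Q z - c) < 1 by near: z.
  rewrite -ler_pdivrMr ?cmod_gt0// -cmodV -cmodM (near QE z)//.
  rewrite -(subrK c (ratval Q z)) addrC (le_trans (ler_cmodD _ _))//.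
  by rewrite lerD2l ltW.
Unshelve. all: by end_near. Qed.
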